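(* Let $B$ be a standard Koszul Artin-Schelter Gorenstein algebra of (graded) injective dimension $d$, and let $S=B_0$. Then the graded modules $S_B$ and ${}_BS$ are of projective dimension $d$.
   Context: $\Bbbk$ is a fixed field. $B=\bigoplus_{i\ge0}B_i$ is a positively graded $\Bbbk$-algebra with $\dim_\Bbbk B_i<\infty$ for all $i$, and $S=B_0$ (a finite dimensional algebra, not assumed semisimple); $S_B$, ${}_BS$ denote $S=B/B_{\ge1}$ as graded right, left $B$-module. $B$ is Artin-Schelter Gorenstein if: (i) the graded injective dimensions satisfy $\mathrm{injdim}\,B_B=\mathrm{injdim}\,{}_BB=d<\infty$; (ii) as graded (left) $B$-modules, $\underline{\mathrm{Ext}}^i_B(S_B,B)=0$ for $i\ne d$ and $\underline{\mathrm{Ext}}^d_B(S_B,B)\cong D(S)(l)$, where $D(S)=\mathrm{Hom}_\Bbbk(S,\Bbbk)$ is viewed as a graded $B$-module concentrated in degree zero and $(l)$ is the degree shift $N(l)_i=N_{i+l}$; (iii) the left version of (ii) holds (for $\underline{\mathrm{Ext}}^i_B({}_BS,B)$ as graded right $B$-modules). The integer $l$ is the Gorenstein parameter. $B$ is Koszul if every $B_i$ ($i\ge1$) is projective as a left and as a right $S$-module, and $S_B$ has a graded projective resolution whose $n$-th term is generated in degree $n$ for all $n\ge0$. $B$ is standard Koszul Artin-Schelter Gorenstein if it is Artin-Schelter Gorenstein, Koszul, and its Gorenstein parameter equals its graded injective dimension, $l=d$. *)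

(* Defs.v *)
From HB Require Import structures.
From mathcomp Require Import all_boot all_order all_algebra.
From mathcomp Require Import generic_quotient ring_quotient.
From mathcomp Require Import boolp functions.

Set Implicit Arguments.
Unset Strict Implicit.
Unset Printing Implicit Defensive.

Import Order.TTheory GRing.Theory Num.Theory.
Local Open Scope ring_scope.
Local Open Scope quotient_scope.

(* A Z-grading V = (+)_n V_n, given by its family of projections onto V_n. *)
Record grading (V : zmodType) := Grading {
  gcomp :> int -> V -> V;
  gcompB : forall n, zmod_morphism (gcomp n);
  gcompK : forall m n x, gcomp m (gcomp n x) = if m == n then gcomp n x else 0;
  gcomp_fin : forall x,
    exists s : seq int, uniq s && (x == \sum_(n <- s) gcomp n x) }.

HB.instance Definition _ (V : zmodType) (g : grading V) n :=
  GRing.isZmodMorphism.Build V V (gcomp g n) (gcompB g n).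

Definition homog (V : zmodType) (g : grading V) (n : int) : {pred V} :=
  fun x => g n x == x.

Section GradingTheory.
Variables (V : zmodType) (g : grading V).

Definition gsupp (x : V) : seq int := xchoose (gcomp_fin g x).

Lemma homogE n x : (x \in homog g n) = (g n x == x). Proof. by []. Qed.

Lemma gcomp_in n x : g n x \in homog g n.
Proof. by rewrite homogE gcompK eqxx. Qed.

Lemma gcomp_homog m n x : x \in homog g n -> g m x = if m == n then x else 0.
Proof. by move=> /eqP <-; exact: gcompK. Qed.

Lemma gsuppP x : uniq (gsupp x) /\ x = \sum_(n <- gsupp x) g n x.
Proof. by have /andP[? /eqP] := xchooseP (gcomp_fin g x). Qed.

Lemma gcomp_out s x n : x = \sum_(m <- s) g m x -> n \notin s -> g n x = 0.
Proof.
move=> ex ns; rewrite ex raddf_sum big_seq big1 // => m ms.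
by rewrite /= gcompK; case: eqP => // e; rewrite e ms in ns.
Qed.

Lemma gsupp_out x n : n \notin gsupp x -> g n x = 0.
Proof. by apply: gcomp_out; case: (gsuppP x). Qed.

Lemma homog_ind (P : V -> Prop) : P 0 -> (forall x y, P x -> P y -> P (x + y)) ->
  (forall n x, x \in homog g n -> P x) -> forall x, P x.
Proof.
move=> P0 PD Ph x; have [_ ->] := gsuppP x.
by elim/big_ind: _ => // n _; apply: (Ph n); exact: gcomp_in.
Qed.

Lemma eq_sum_supp (W : zmodType) (F : int -> W) (s t : seq int) :
  uniq s -> uniq t -> (forall n, n \notin s -> F n = 0) ->
  (forall n, n \notin t -> F n = 0) -> \sum_(n <- s) F n = \sum_(n <- t) F n.
Proof.
move=> us ut Fs Ft.
have aux u v : uniq u -> uniq v -> (forall n, n \notin v -> F n = 0) ->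
    \sum_(n <- u) F n = \sum_(n <- [seq x <- u | x \in v]) F n.
  move=> uu uv Fv; rewrite big_filter (bigID (fun n => n \in v)) /=.
  by rewrite [X in _ + X]big1 ?addr0 // => n /Fv.
rewrite (aux s t) // (aux t s) //; apply: perm_big; apply: uniq_perm.
- exact: filter_uniq.
- exact: filter_uniq.
- by move=> n; rewrite !mem_filter andbC.
Qed.

Lemma sum_gcomp s x : uniq s -> (forall n, n \notin s -> g n x = 0) ->
  x = \sum_(n <- s) g n x.
Proof.
move=> us h; have [ut {1}->] := gsuppP x.
by apply: (eq_sum_supp ut us) => // n; exact: gsupp_out.
Qed.

Definition gsum (W : zmodType) (G : int -> V -> W) (x : V) : W :=
  \sum_(n <- gsupp x) G n (g n x).

Lemma gsumE (W : zmodType) (G : int -> V -> W) s x :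
  (forall n, G n 0 = 0) -> uniq s -> (forall n, n \notin s -> g n x = 0) ->
  gsum G x = \sum_(n <- s) G n (g n x).
Proof.
move=> G0 us h; have [ut _] := gsuppP x.
by apply: (eq_sum_supp ut us) => n ns; rewrite ?(gsupp_out ns) ?h.
Qed.

Lemma gsum_homog (W : zmodType) (G : int -> V -> W) n x :
  (forall n, G n 0 = 0) -> x \in homog g n -> gsum G x = G n x.
Proof.
move=> G0 hx; rewrite (@gsumE _ _ [:: n]) //=.
  by rewrite big_seq1 (gcomp_homog _ hx) eqxx.
by move=> m; rewrite inE (gcomp_homog _ hx) => /negbTE->.
Qed.

Lemma gsumD (W : zmodType) (G : int -> V -> W) :
  (forall n x y, G n (x + y) = G n x + G n y) ->
  forall x y, gsum G (x + y) = gsum G x + gsum G y.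
Proof.
move=> GD x y.
have G0 n : G n 0 = 0 by apply: (@addrI _ (G n 0)); rewrite -GD !addr0.
pose s := undup (gsupp x ++ gsupp y).
have us : uniq s by exact: undup_uniq.
have hx n : n \notin s -> g n x = 0.
  by rewrite mem_undup mem_cat => /norP[/gsupp_out].
have hy n : n \notin s -> g n y = 0.
  by rewrite mem_undup mem_cat => /norP[_ /gsupp_out].
rewrite !(@gsumE _ G s) //; last by move=> n ns; rewrite raddfD/= hx ?hy ?addr0.
by rewrite -big_split; apply: eq_bigr => n _; rewrite raddfD GD.
Qed.

End GradingTheory.

(* The grading concentrated in degree 0, and the shift V(l)_n = V_(n + l). *)
Section Concentrated.
Variable V : zmodType.
Definition conc_comp (n : int) (x : V) := if n == 0 then x else 0.
Lemma conc_compB n : zmod_morphism (conc_comp n).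
Proof. by move=> x y; rewrite /conc_comp; case: eqP; rewrite ?subr0. Qed.
Lemma conc_compK m n x :
  conc_comp m (conc_comp n x) = if m == n then conc_comp n x else 0.
Proof.
rewrite /conc_comp; have [->|mn] := eqVneq m n; first by case: eqP.
by case: (eqVneq m 0) => // m0; case: eqP => // n0; rewrite m0 n0 eqxx in mn.
Qed.
Lemma conc_comp_fin x :
  exists s : seq int, uniq s && (x == \sum_(n <- s) conc_comp n x).
Proof. by exists [:: 0]; rewrite big_seq1 /=. Qed.
Definition conc_grading := Grading conc_compB conc_compK conc_comp_fin.
End Concentrated.

Section ShiftGrading.
Variables (V : zmodType) (g : grading V) (l : int).
Definition shift_comp (n : int) (x : V) := g (n + l) x.
Lemma shift_compB n : zmod_morphism (shift_comp n).
Proof. exact: gcompB. Qed.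
Lemma shift_compK m n x :
  shift_comp m (shift_comp n x) = if m == n then shift_comp n x else 0.
Proof. by rewrite /shift_comp gcompK (inj_eq (addIr l)). Qed.
Lemma shift_comp_fin x :
  exists s : seq int, uniq s && (x == \sum_(n <- s) shift_comp n x).
Proof.
have [us ex] := gsuppP g x; exists [seq n - l | n <- gsupp g x].
rewrite map_inj_uniq ?us /=; last exact: addIr.
by rewrite big_map {1}ex; apply/eqP/eq_bigr => n _; rewrite /shift_comp subrK.
Qed.
Definition shift_grading := Grading shift_compB shift_compK shift_comp_fin.
End ShiftGrading.

(* Positively graded locally finite k-algebras; degrees range over int, the
   negative ones vanishing. *)
Record gralg (k : fieldType) := GrAlg {
  galg :> algType k;
  algr : grading galg;
  algrZ : forall n (c : k) x, algr n (c *: x) = c *: algr n x;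
  algr1 : 1 \in homog algr 0;
  algrM : forall m n x y,
    x \in homog algr m -> y \in homog algr n -> x * y \in homog algr (m + n);
  algr_pos : forall n x, n < 0 -> algr n x = 0;
  algr_fdim : forall n, exists s : seq galg, forall x, x \in homog algr n ->
    exists c : nat -> k, x = \sum_(i < size s) c i *: s`_i }.

(* Graded left modules; graded right A-modules are graded left modules over
   the opposite algebra (gr_opp A below). *)
Record grmod (k : fieldType) (A : gralg k) := GrMod {
  gmod :> lmodType A;
  mgr : grading gmod;
  mgrZ : forall m n a x,
    a \in homog (algr A) m -> x \in homog mgr n -> a *: x \in homog mgr (m + n) }.

Section Opposite.
Variables (k : fieldType).

HB.instance Definition _ (A : algType k) := GRing.Lmodule.copy A^c A.

Section Alg.
Variable A : algType k.
Lemma opp_scalerAl (c : k) (x y : A^c) : c *: (x * y) = (c *: x : A^c) * y.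
Proof. exact: (@scalerAr k A c y x). Qed.
HB.instance Definition _ := GRing.Lmodule_isLalgebra.Build k A^c opp_scalerAl.
Lemma opp_scalerAr (c : k) (x y : A^c) : c *: (x * y) = x * (c *: y : A^c).
Proof. exact: (@scalerAl k A c y x). Qed.
HB.instance Definition _ := GRing.Lalgebra_isAlgebra.Build k A^c opp_scalerAr.
End Alg.

Variable A : gralg k.
Let g : grading A^c := algr A.
Lemma opp_algrM m n (x y : A^c) :
  x \in homog g m -> y \in homog g n -> x * y \in homog g (m + n).
Proof. by move=> hx hy; rewrite addrC; exact: (algrM hy hx). Qed.
Definition gr_opp : gralg k :=
  @GrAlg k A^c g (@algrZ k A) (@algr1 k A) opp_algrM (@algr_pos k A)
    (@algr_fdim k A).
End Opposite.

Section Algebra.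
Variables (k : fieldType) (A : gralg k).

Lemma algr0M (a b : A) : algr A 0 (a * b) = algr A 0 a * algr A 0 b.
Proof.
elim/(homog_ind (g := algr A)): a => [|a1 a2 h1 h2|m a ha].
- by rewrite mul0r raddf0 mul0r.
- by rewrite mulrDl !raddfD/= h1 h2 mulrDl.
elim/(homog_ind (g := algr A)): b => [|b1 b2 h1 h2|n b hb].
- by rewrite mulr0 raddf0 mulr0.
- by rewrite mulrDr !raddfD/= h1 h2 mulrDr.
have [m0|m0] := ltP m 0.
  have -> : a = 0 by rewrite -(eqP ha) algr_pos.
  by rewrite mul0r raddf0 mul0r.
have [n0|n0] := ltP n 0.
  have -> : b = 0 by rewrite -(eqP hb) algr_pos.
  by rewrite mulr0 raddf0 mulr0.
rewrite (gcomp_homog _ (algrM ha hb)) (gcomp_homog _ ha) (gcomp_homog _ hb).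
rewrite ![0 == _]eq_sym; have [->|mn] := eqVneq m 0.
  by rewrite add0r; case: eqP; rewrite ?mulr0.
by rewrite mul0r paddr_eq0 // (negbTE mn).
Qed.

Lemma mulrgZ m n (a x : A) : a \in homog (algr A) m -> x \in homog (algr A) n ->
  (a *: (x : A^o) : A) \in homog (algr A) (m + n).
Proof. exact: algrM. Qed.

Definition regmod : grmod A := @GrMod k A A^o (algr A) mulrgZ.

Lemma homog_zmod_closed n : zmod_closed (homog (algr A) n).
Proof.
split=> [|x y /eqP hx /eqP hy]; first by rewrite homogE raddf0.
by rewrite homogE raddfB/= hx hy.
Qed.
HB.instance Definition _ n :=
  GRing.isZmodClosed.Build A (homog (algr A) n) (homog_zmod_closed n).

Lemma homogZ n (c : k) x : x \in homog (algr A) n -> c *: x \in homog (algr A) n.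
Proof. by rewrite !homogE algrZ => /eqP->. Qed.

Definition homog0 : {pred A} := homog (algr A) 0.
Lemma homog0_subalg_closed : GRing.subalg_closed homog0.
Proof.
split=> [|c x y hx hy|x y hx hy]; first exact: algr1.
  by apply: (rpredD (S := homog (algr A) 0)) => //; exact: homogZ.
exact: (algrM hx hy).
Qed.
HB.instance Definition _ :=
  GRing.isSubalgClosed.Build k A homog0 homog0_subalg_closed.

(* The algebra S = A_0. *)
Record deg0 := Deg0 { deg0_val :> A; deg0P : deg0_val \in homog0 }.
HB.instance Definition _ := [isSub for deg0_val].
HB.instance Definition _ := [Choice of deg0 by <:].
HB.instance Definition _ := [SubChoice_isSubAlgebra of deg0 by <:].

(* A_n as a left S-module. *)
Record piece (n : int) :=
  Piece { piece_val :> A; pieceP : piece_val \in homog (algr A) n }.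
HB.instance Definition _ n := [isSub for @piece_val n].
HB.instance Definition _ n := [Choice of piece n by <:].
HB.instance Definition _ n := [SubChoice_isSubZmodule of piece n by <:].

Section PieceModule.
Variable n : int.
Lemma piece_scale_subproof (s : deg0) (x : piece n) :
  (s : A) * (x : A) \in homog (algr A) n.
Proof. by have := algrM (deg0P s) (pieceP x); rewrite add0r. Qed.
Definition piece_scale s x : piece n := Piece (piece_scale_subproof s x).
Lemma piece_scaleA s t x : piece_scale s (piece_scale t x) = piece_scale (s * t) x.
Proof. by apply: val_inj; rewrite /= mulrA. Qed.
Lemma piece_scale1 : left_id 1 piece_scale.
Proof. by move=> x; apply: val_inj; rewrite /= mul1r. Qed.
Lemma piece_scaleDr : right_distributive piece_scale +%R.
Proof. by move=> s x y; apply: val_inj; rewrite /= mulrDr. Qed.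
Lemma piece_scaleDl x : {morph piece_scale^~ x : s t / s + t}.
Proof. by move=> s t; apply: val_inj; rewrite /= mulrDl. Qed.
HB.instance Definition _ := GRing.Zmodule_isLmodule.Build deg0 (piece n)
  piece_scaleA piece_scale1 piece_scaleDr piece_scaleDl.
End PieceModule.

Definition proj0 (a : A) : deg0 := Deg0 (gcomp_in (algr A) 0 a).
Lemma proj0M a b : proj0 (a * b) = proj0 a * proj0 b.
Proof. by apply: val_inj; rewrite /= algr0M. Qed.
Lemma proj0_1 : proj0 1 = 1.
Proof. by apply: val_inj; apply/eqP; exact: algr1. Qed.
Lemma proj0D a b : proj0 (a + b) = proj0 a + proj0 b.
Proof. by apply: val_inj; rewrite /= raddfD. Qed.
Lemma proj0_homog n a : n != 0 -> a \in homog (algr A) n -> proj0 a = 0.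
Proof.
by move=> n0 ha; apply: val_inj; rewrite /= (gcomp_homog _ ha) eq_sym (negbTE n0).
Qed.

(* S = A / A_(>= 1) as a graded left A-module concentrated in degree 0: its
   underlying group is A_0 and A acts through the projection A -> A_0. *)
Definition deg0mod : Type := deg0.
HB.instance Definition _ := GRing.Zmodule.on deg0mod.
Definition deg0mod_scale (a : A) (s : deg0mod) : deg0mod := proj0 a * (s : deg0).
Lemma deg0mod_scaleA a b s :
  deg0mod_scale a (deg0mod_scale b s) = deg0mod_scale (a * b) s.
Proof. by rewrite /deg0mod_scale proj0M mulrA. Qed.
Lemma deg0mod_scale1 : left_id 1 deg0mod_scale.
Proof. by move=> s; rewrite /deg0mod_scale proj0_1 mul1r. Qed.
Lemma deg0mod_scaleDr : right_distributive deg0mod_scale +%R.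
Proof. by move=> a s t; rewrite /deg0mod_scale mulrDr. Qed.
Lemma deg0mod_scaleDl s : {morph deg0mod_scale^~ s : a b / a + b}.
Proof. by move=> a b; rewrite /deg0mod_scale proj0D mulrDl. Qed.
HB.instance Definition _ := GRing.Zmodule_isLmodule.Build A deg0mod
  deg0mod_scaleA deg0mod_scale1 deg0mod_scaleDr deg0mod_scaleDl.

Lemma conc_scale (V : lmodType A) m n (a : A) (x : V) :
  (forall m a x, m != 0 -> a \in homog (algr A) m -> a *: (x : V) = 0) ->
  a \in homog (algr A) m -> x \in homog (conc_grading V) n ->
  a *: x \in homog (conc_grading V) (m + n).
Proof.
move=> h ha hx; have [m0|m0] := eqVneq m 0; last first.
  by rewrite (h m) // homogE raddf0.
rewrite m0 add0r; move: hx; rewrite !homogE /= /conc_comp.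
case: (n == 0) => [_|/eqP <-]; by rewrite ?scaler0 eqxx.
Qed.

Lemma deg0mod_pos m a (x : deg0mod) : m != 0 -> a \in homog (algr A) m -> a *: x = 0.
Proof. by move=> m0 /(proj0_homog m0) e; rewrite /GRing.scale/= /deg0mod_scale e mul0r. Qed.

Definition Smod : grmod A :=
  @GrMod k A deg0mod (conc_grading _)
    (fun m n a x => conc_scale (@deg0mod_pos)).

End Algebra.

(* D(S) = Hom_k(S, k), S the left A-module A_0: a right A-module, i.e. a left
   module over gr_opp A, for (f a)(s) = f (a s). *)
Section Dual.
Variables (k : fieldType) (A : gralg k).

Definition dual_pred : {pred (deg0 A -> k^o)} := fun f => `[< linear f >].
Record dual := Dual { dual_fun :> deg0 A -> k^o; dualP : dual_fun \in dual_pred }.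
HB.instance Definition _ := [isSub for dual_fun].
HB.instance Definition _ := [Choice of dual by <:].
Lemma dual_zmod_closed : zmod_closed dual_pred.
Proof.
split=> [|f g /asboolP hf /asboolP hg]; apply/asboolP => c x y.
  by rewrite scaler0 addr0.
change (f (c *: x + y) - g (c *: x + y) = c *: (f x - g x) + (f y - g y)).
by rewrite hf hg scalerBr opprD addrACA.
Qed.
HB.instance Definition _ :=
  GRing.isZmodClosed.Build (deg0 A -> k^o) dual_pred dual_zmod_closed.
HB.instance Definition _ := [SubChoice_isSubZmodule of dual by <:].

Lemma dual_linear (f : dual) : linear f.
Proof. exact: (asboolW (dualP f)). Qed.

Lemma dual_scale_subproof (a : gr_opp A) (f : dual) :
  (fun s => f (proj0 (a : A) * s)) \in dual_pred.
Proof.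
by apply/asboolP => c x y; rewrite mulrDr -scalerAr dual_linear.
Qed.
Definition dual_scale a f : dual := Dual (dual_scale_subproof a f).
Lemma dual_scaleA a b f : dual_scale a (dual_scale b f) = dual_scale (a * b) f.
Proof.
by apply: val_inj; apply/funext => s; rewrite /= mulrA -proj0M.
Qed.
Lemma dual_scale1 : left_id 1 dual_scale.
Proof. by move=> f; apply: val_inj; apply/funext => s; rewrite /= proj0_1 mul1r. Qed.
Lemma dual_scaleDr : right_distributive dual_scale +%R.
Proof. by move=> a f g; apply: val_inj. Qed.
Lemma dual_scaleDl f : {morph dual_scale^~ f : a b / a + b}.
Proof.
move=> a b; apply: val_inj; apply/funext => s /=.
rewrite proj0D mulrDl -[proj0 (a : A) * s]scale1r dual_linear scale1r.
by rewrite -[RHS]/(f _ + f _).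
Qed.
HB.instance Definition _ := GRing.Zmodule_isLmodule.Build (gr_opp A) dual
  dual_scaleA dual_scale1 dual_scaleDr dual_scaleDl.

Lemma dual_pos m (a : gr_opp A) (f : dual) :
  m != 0 -> a \in homog (algr (gr_opp A)) m -> a *: f = 0.
Proof.
move=> m0 ha; apply: val_inj; apply/funext => s /=.
rewrite (@proj0_homog k A m) // mul0r.
by have := dual_linear f (-1) 0 0; rewrite scaler0 addr0 scaleN1r addNr.
Qed.

Definition dualS : grmod (gr_opp A) :=
  @GrMod k (gr_opp A) dual (conc_grading _) (fun m n a x => conc_scale (@dual_pos)).

End Dual.

Section Modules.
Variables (k : fieldType) (A : gralg k).
Implicit Types M N : grmod A.

Lemma shiftZ M l m n a x :
  a \in homog (algr A) m -> x \in homog (shift_grading (mgr M) l) n ->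
  a *: x \in homog (shift_grading (mgr M) l) (m + n).
Proof. by move=> ha hx; rewrite homogE /= /shift_comp -addrA; exact: (mgrZ ha hx). Qed.
Definition gr_shift M l : grmod A :=
  @GrMod k A M (shift_grading (mgr M) l) (@shiftZ M l).

(* Morphisms of graded modules: linear and degree preserving. *)
Record grhom M N := GrHom {
  ghom :> {linear M -> N};
  ghomC : forall n x, ghom (mgr M n x) = mgr N n (ghom x) }.

Definition gr_iso M N := exists f : grhom M N, bijective f.

Record gsub M := GSub {
  gspred :> {pred M};
  gs_closed : submod_closed gspred;
  gs_comp : forall n x, x \in gspred -> mgr M n x \in gspred }.

HB.instance Definition _ M (U : gsub M) :=
  GRing.isSubmodClosed.Build A M (gspred U) (gs_closed U).

Section Sub.
Variables (M : grmod A) (U : gsub M).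
Record subm := Subm { subm_val :> M; submP : subm_val \in gspred U }.
HB.instance Definition _ := [isSub for subm_val].
HB.instance Definition _ := [Choice of subm by <:].
HB.instance Definition _ := [SubChoice_isSubLmodule of subm by <:].
Definition subm_comp n (x : subm) : subm := Subm (gs_comp n (submP x)).
Lemma subm_compB n : zmod_morphism (subm_comp n).
Proof. by move=> x y; apply: val_inj; rewrite /= raddfB. Qed.
Lemma subm_compK m n x :
  subm_comp m (subm_comp n x) = if m == n then subm_comp n x else 0.
Proof. by apply: val_inj; rewrite /= gcompK; case: eqP. Qed.
Lemma subm_comp_fin x :
  exists s : seq int, uniq s && (x == \sum_(n <- s) subm_comp n x).
Proof.
have [us ex] := gsuppP (mgr M) (subm_val x).
exists (gsupp (mgr M) (subm_val x)); rewrite us /=.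
by apply/eqP/val_inj; rewrite raddf_sum /= {1}ex.
Qed.
Definition subm_grading := Grading subm_compB subm_compK subm_comp_fin.
Lemma submZ m n a x : a \in homog (algr A) m -> x \in homog subm_grading n ->
  a *: x \in homog subm_grading (m + n).
Proof.
move=> ha /eqP hx; apply/eqP/val_inj => /=; apply/eqP.
by apply: (mgrZ ha); rewrite homogE -{2}hx.
Qed.
Definition gsubmod : grmod A := @GrMod k A subm subm_grading submZ.
End Sub.

Section Quot.
Variables (M : grmod A) (U : gsub M).
Definition quotm : Type := Quotient.quot (gspred U : zmodClosed M).
HB.instance Definition _ := GRing.Zmodule.on quotm.
HB.instance Definition _ := EqQuotient.on quotm.
Implicit Types x y : quotm.
Lemma quotmP (x y : M) : reflect (\pi_quotm x = \pi_quotm y) (x - y \in gspred U).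
Proof. by rewrite (Quotient.idealrBE (gspred U : zmodClosed M)); exact: eqP. Qed.
Lemma pi_quotmD (x y : M) : \pi_quotm (x + y) = \pi_quotm x + \pi_quotm y.
Proof. exact: (raddfD (\pi_(Quotient.quot (gspred U : zmodClosed M)))). Qed.
Lemma pi_quotmB (x y : M) : \pi_quotm (x - y) = \pi_quotm x - \pi_quotm y.
Proof. exact: (raddfB (\pi_(Quotient.quot (gspred U : zmodClosed M)))). Qed.
Lemma pi_quotm0 : \pi_quotm 0 = 0 :> quotm.
Proof. exact: (raddf0 (\pi_(Quotient.quot (gspred U : zmodClosed M)))). Qed.
Lemma pi_quotm_sum (I : Type) (s : seq I) (F : I -> M) :
  \pi_quotm (\sum_(i <- s) F i) = \sum_(i <- s) \pi_quotm (F i).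
Proof. exact: (raddf_sum (\pi_(Quotient.quot (gspred U : zmodClosed M)))). Qed.

Definition quotm_scale (a : A) x : quotm := \pi_quotm (a *: repr x).
Lemma pi_quotmZ a (x : M) : quotm_scale a (\pi_quotm x) = \pi_quotm (a *: x).
Proof.
by apply/quotmP; rewrite -scalerBr; apply: rpredZ; apply/quotmP; rewrite reprK.
Qed.
Lemma quotm_scaleA a b x : quotm_scale a (quotm_scale b x) = quotm_scale (a * b) x.
Proof. by rewrite -[x]reprK !pi_quotmZ scalerA !reprK. Qed.
Lemma quotm_scale1 : left_id 1 quotm_scale.
Proof. by move=> x; rewrite -[x]reprK pi_quotmZ scale1r. Qed.
Lemma quotm_scaleDr : right_distributive quotm_scale +%R.
Proof.
move=> a x y; rewrite -[x]reprK -[y]reprK -pi_quotmD !pi_quotmZ.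
by rewrite scalerDr pi_quotmD.
Qed.
Lemma quotm_scaleDl x : {morph quotm_scale^~ x : a b / a + b}.
Proof. by move=> a b; rewrite -[x]reprK !pi_quotmZ scalerDl pi_quotmD. Qed.
HB.instance Definition _ := GRing.Zmodule_isLmodule.Build A quotm
  quotm_scaleA quotm_scale1 quotm_scaleDr quotm_scaleDl.

Definition quotm_comp n x : quotm := \pi_quotm (mgr M n (repr x)).
Lemma pi_quotm_comp n (x : M) : quotm_comp n (\pi_quotm x) = \pi_quotm (mgr M n x).
Proof.
by apply/quotmP; rewrite -raddfB; apply: gs_comp; apply/quotmP; rewrite reprK.
Qed.
Lemma quotm_compB n : zmod_morphism (quotm_comp n).
Proof.
move=> x y; rewrite -[x]reprK -[y]reprK -pi_quotmB !pi_quotm_comp.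
by rewrite raddfB pi_quotmB.
Qed.
Lemma quotm_compK m n x :
  quotm_comp m (quotm_comp n x) = if m == n then quotm_comp n x else 0.
Proof.
rewrite -[x]reprK !pi_quotm_comp gcompK reprK; case: (m == n) => //.
exact: pi_quotm0.
Qed.
Lemma quotm_comp_fin x :
  exists s : seq int, uniq s && (x == \sum_(n <- s) quotm_comp n x).
Proof.
rewrite -[x]reprK; have [us ex] := gsuppP (mgr M) (repr x).
exists (gsupp (mgr M) (repr x)); rewrite us /= {1}ex pi_quotm_sum.
by apply/eqP/eq_bigr => n _; rewrite pi_quotm_comp.
Qed.
Definition quotm_grading := Grading quotm_compB quotm_compK quotm_comp_fin.
Lemma quotm_mgrZ m n a x : a \in homog (algr A) m -> x \in homog quotm_grading n ->
  a *: x \in homog quotm_grading (m + n).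
Proof.
move=> ha; rewrite homogE => /eqP <-; rewrite /= /quotm_comp.
rewrite -[_ *: _]/(quotm_scale _ _) pi_quotmZ homogE /= pi_quotm_comp.
by apply/eqP; congr (\pi_quotm _); apply/eqP; apply: (mgrZ ha); exact: gcomp_in.
Qed.
Definition gquot : grmod A := @GrMod k A quotm quotm_grading quotm_mgrZ.
End Quot.

Section KerIm.
Variables (M N : grmod A) (f : grhom M N).

Lemma gker_closed : submod_closed (fun x => f x == 0 : bool).
Proof.
split=> [|a x y]; rewrite !unfold_in ?raddf0 // linearP => /eqP-> /eqP->.
by rewrite scaler0 addr0.
Qed.
Lemma gker_comp n x : x \in (fun x => f x == 0) -> mgr M n x \in (fun x => f x == 0).
Proof. by rewrite !unfold_in ghomC => /eqP->; rewrite raddf0. Qed.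
Definition gker : gsub M := GSub gker_closed gker_comp.

Lemma gim_closed : submod_closed (fun y => `[< exists x, y = f x >]).
Proof.
split=> [|a x y]; first by apply/asboolP; exists 0; rewrite raddf0.
move=> /asboolP[u ->] /asboolP[v ->]; apply/asboolP.
by exists (a *: u + v); rewrite linearP.
Qed.
Lemma gim_comp n y : y \in (fun y => `[< exists x, y = f x >]) ->
  mgr N n y \in (fun y => `[< exists x, y = f x >]).
Proof.
by move=> /asboolP[u ->]; apply/asboolP; exists (mgr M n u); rewrite ghomC.
Qed.
Definition gim : gsub N := GSub gim_closed gim_comp.
End KerIm.

Lemma gzero_closed M : submod_closed (fun x : M => x == 0).
Proof.
by split=> [|a x y]; rewrite !unfold_in // => /eqP-> /eqP->; rewrite scaler0 addr0.
Qed.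
Lemma gzero_comp M n x : x \in (fun x : M => x == 0) -> mgr M n x \in (fun x : M => x == 0).
Proof. by rewrite !unfold_in => /eqP->; rewrite raddf0. Qed.
Definition gzero M : gsub M := GSub (@gzero_closed M) (@gzero_comp M).

Lemma grestr_closed M (Z U : gsub M) :
  submod_closed (fun z : gsubmod Z => subm_val z \in gspred U).
Proof.
split=> [|a x y]; first exact: (rpred0 (gspred U)).
have h (u v : M) : u \in gspred U -> v \in gspred U -> a *: u + v \in gspred U.
  by move=> hu hv; apply: rpredD => //; exact: rpredZ.
exact: (h (subm_val x) (subm_val y)).
Qed.
Lemma grestr_comp M (Z U : gsub M) n z :
  z \in (fun z : gsubmod Z => subm_val z \in gspred U) ->
  mgr (gsubmod Z) n z \in (fun z : gsubmod Z => subm_val z \in gspred U).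
Proof. exact: (@gs_comp M U n (subm_val z)). Qed.
(* The trace of U on the submodule Z. *)
Definition grestr M (Z U : gsub M) : gsub (gsubmod Z) :=
  GSub (@grestr_closed M Z U) (@grestr_comp M Z U).

Definition gr_projective (P : grmod A) := forall M N (p : grhom M N) (f : grhom P N),
  (forall y, exists x, p x = y) -> exists h : grhom P M, forall x, p (h x) = f x.

Definition gr_injective (I : grmod A) := forall M N (i : grhom M N) (f : grhom M I),
  injective i -> exists h : grhom N I, forall x, h (i x) = f x.

Record proj_resolution M := ProjResolution {
  pr_obj :> nat -> grmod A;
  pr_diff : forall n, grhom (pr_obj n.+1) (pr_obj n);
  pr_aug : grhom (pr_obj 0) M;
  pr_proj : forall n, gr_projective (pr_obj n);
  pr_aug_surj : forall y, exists x, pr_aug x = y;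
  pr_exact0 : forall x, pr_aug x = 0 <-> exists y, x = pr_diff 0 y;
  pr_exact : forall n x, pr_diff n x = 0 <-> exists y, x = pr_diff n.+1 y }.

Record inj_resolution M := InjResolution {
  ir_obj :> nat -> grmod A;
  ir_diff : forall n, grhom (ir_obj n) (ir_obj n.+1);
  ir_aug : grhom M (ir_obj 0);
  ir_inj : forall n, gr_injective (ir_obj n);
  ir_aug_inj : injective ir_aug;
  ir_exact0 : forall x, ir_diff 0 x = 0 <-> exists y, x = ir_aug y;
  ir_exact : forall n x, ir_diff n.+1 x = 0 <-> exists y, x = ir_diff n y }.

(* Graded dimensions: the least length of a graded resolution. *)
Definition pdim_le M (d : nat) := exists P : proj_resolution M,
  forall n, (d < n)%N -> forall x : P n, x = 0.
Definition pdim_eq M (d : nat) := pdim_le M d /\ forall m, pdim_le M m -> (d <= m)%N.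

Definition injdim_le M (d : nat) := exists I : inj_resolution M,
  forall n, (d < n)%N -> forall x : I n, x = 0.
Definition injdim_eq M (d : nat) :=
  injdim_le M d /\ forall m, injdim_le M m -> (d <= m)%N.

Definition generated_in_degree M (n : int) := forall x : M,
  exists s : seq (A * M), (forall p, p \in s -> p.2 \in homog (mgr M) n) /\
    x = \sum_(p <- s) p.1 *: p.2.

End Modules.

(* The graded module (+)_n Hom_gr(M, A(n)): A-linear maps M -> A that are finite
   sums of homogeneous ones, i.e. for some finite set s of degrees map each M_i
   into (+)_(n in s) A_(i + n).  It is a right A-module for (f a)(x) = f x * a,
   which is the pointwise structure on functions M -> (gr_opp A)^o. *)
Section HomModule.
Variables (k : fieldType) (A : gralg k) (M : grmod A).

Definition hom_pred : {pred (M -> (gr_opp A)^o)} := fun f => `[<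
  (forall (a : A) x y, f (a *: x + y) = (a : A) * (f x : A) + f y :> A) /\
  exists s : seq int, forall n, n \notin s ->
    forall i x, x \in homog (mgr M) i -> algr A (i + n) (f x) = 0 >].

Record homm := Homm { homm_fun :> M -> (gr_opp A)^o; hommP : homm_fun \in hom_pred }.
HB.instance Definition _ := [isSub for homm_fun].
HB.instance Definition _ := [Choice of homm by <:].

Lemma hom_closed : submod_closed hom_pred.
Proof.
split=> [|b f g].
  apply/asboolP; split=> [a x y|]; first by rewrite /= mulr0 addr0.
  by exists [::] => n _ i x _; rewrite raddf0.
move=> /asboolP[lf [s hs]] /asboolP[lg [t ht]]; apply/asboolP; split.
  move=> a x y.
  change ((f (a *: x + y) : A) * (b : A) + g (a *: x + y) =
    a * ((f x : A) * (b : A) + g x) + ((f y : A) * (b : A) + g y) :> A).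
  rewrite lf lg.
  by rewrite !mulrDl mulrDr !mulrA addrACA.
pose u := [seq n + j | n <- s, j <- gsupp (algr A) (b : A)] ++ t.
exists u => n; rewrite mem_cat => /norP[nu nt] i x hx.
rewrite -[(_ + _) x]/((f x : A) * (b : A) + g x) raddfD/= (ht n) // addr0.
have [_ ->] := gsuppP (algr A) (b : A).
rewrite mulr_sumr raddf_sum big_seq big1 // => j jb /=.
have [_ ->] := gsuppP (algr A) (f x : A).
rewrite mulr_suml raddf_sum big1 // => m _ /=.
rewrite (gcomp_homog _ (algrM (gcomp_in _ _ _) (gcomp_in _ _ _))).
case: eqP => // e.
have [ms|ms] := boolP (m - i \in s); last first.
  by have := hs _ ms _ _ hx; rewrite addrC subrK => ->; rewrite mul0r.
case/negP: nu; apply/allpairsP; exists (m - i, j); split => //=.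
by apply: (addrI i); rewrite e addrA [i + (m - i)]addrC subrK.
Qed.
HB.instance Definition _ :=
  GRing.isSubmodClosed.Build (gr_opp A) (M -> (gr_opp A)^o) hom_pred hom_closed.
HB.instance Definition _ := [SubChoice_isSubLmodule of homm by <:].

Lemma homm_lin (f : homm) (a : A) x y :
  f (a *: x + y) = (a : A) * (f x : A) + f y :> A.
Proof. by have [] := asboolW (hommP f). Qed.
Lemma hommD (f : homm) x y : f (x + y) = f x + f y :> A.
Proof. by rewrite -[x]scale1r homm_lin mul1r scale1r. Qed.
Lemma homm0 (f : homm) : f 0 = 0 :> A.
Proof. by apply: (@addrI _ (f 0 : A)); rewrite -hommD !addr0. Qed.
Lemma hommZ (f : homm) (a : A) x : f (a *: x) = a * (f x : A) :> A.
Proof. by rewrite -[a *: x]addr0 homm_lin homm0 addr0. Qed.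

Lemma eq_homm (f g : homm) :
  (forall i x, x \in homog (mgr M) i -> f x = g x) -> f = g.
Proof.
move=> fg; apply: val_inj; apply/funext => x /=.
elim/(homog_ind (g := mgr M)): x => [|x y hx hy|i x /fg//].
  by rewrite [LHS]homm0 [RHS]homm0.
by rewrite [LHS]hommD [RHS]hommD; congr (_ + _).
Qed.

(* The degree n part of f sends x in M_i to the degree i + n part of f x. *)
Definition homm_comp_fun n (f : homm) : M -> (gr_opp A)^o :=
  gsum (mgr M) (fun i x => algr A (i + n) (f x)).
Lemma homm_comp_funD n f x y : homm_comp_fun n f (x + y) =
  homm_comp_fun n f x + homm_comp_fun n f y.
Proof. by apply: gsumD => i u v; rewrite hommD raddfD. Qed.
Lemma homm_comp_funE n f i x : x \in homog (mgr M) i ->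
  homm_comp_fun n f x = algr A (i + n) (f x).
Proof. by apply: gsum_homog => j; rewrite homm0 raddf0. Qed.
Lemma homm_comp_fun0 n f : homm_comp_fun n f 0 = 0.
Proof. by apply: (@addrI _ (homm_comp_fun n f 0)); rewrite -homm_comp_funD !addr0. Qed.

Lemma algr_homogM m (a y : A) n : a \in homog (algr A) m ->
  algr A (m + n) (a * y) = a * algr A n y.
Proof.
move=> ha; elim/(homog_ind (g := algr A)): y => [|y z hy hz|j y hy].
- by rewrite !(mulr0, raddf0).
- by rewrite mulrDr !raddfD/= hy hz mulrDr.
rewrite (gcomp_homog _ (algrM ha hy)) (gcomp_homog _ hy) (inj_eq (addrI m)).
by case: eqP; rewrite ?mulr0.
Qed.

Lemma homm_comp_subproof n f : homm_comp_fun n f \in hom_pred.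
Proof.
apply/asboolP; split; last first.
  exists [:: n] => m; rewrite inE => mn i x hx.
  by rewrite (homm_comp_funE _ _ hx) gcompK (inj_eq (addrI i)) (negbTE mn).
move=> a x y; rewrite homm_comp_funD; congr (_ + _).
elim/(homog_ind (g := algr A)): a => [|a b ha hb|m a ha].
- by rewrite scale0r mul0r homm_comp_fun0.
- by rewrite scalerDl homm_comp_funD mulrDl; congr (_ + _).
elim/(homog_ind (g := mgr M)): x => [|u v hu hv|i x hx].
- by rewrite scaler0 [X in a * X]homm_comp_fun0 homm_comp_fun0 mulr0.
- rewrite scalerDr homm_comp_funD [X in a * X]homm_comp_funD mulrDr.
  by congr (_ + _).
rewrite (homm_comp_funE _ _ (mgrZ ha hx)) [X in a * X](homm_comp_funE _ _ hx).
by rewrite hommZ -addrA algr_homogM.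
Qed.
Definition homm_comp n f : homm := Homm (homm_comp_subproof n f).

Lemma homm_compE n f i x : x \in homog (mgr M) i ->
  homm_comp n f x = algr A (i + n) (f x).
Proof. exact: homm_comp_funE. Qed.

Lemma homm_compB n : zmod_morphism (homm_comp n).
Proof.
move=> f g; apply: eq_homm => i x hx.
rewrite (homm_compE _ _ hx).
rewrite -[RHS]/((homm_comp n f x : A) - (homm_comp n g x : A)).
by rewrite !(homm_compE _ _ hx) -raddfB.
Qed.
Lemma homm_compK m n f :
  homm_comp m (homm_comp n f) = if m == n then homm_comp n f else 0.
Proof.
apply: eq_homm => i x hx; rewrite !(homm_compE _ _ hx) gcompK (inj_eq (addrI i)).
by case: eqP => // _; rewrite (homm_compE _ _ hx).
Qed.
Lemma homm_sumE (I : Type) (s : seq I) (F : I -> homm) x :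
  (\sum_(i <- s) F i) x = \sum_(i <- s) (F i x : A) :> A.
Proof.
elim: s => [|i s IH]; first by rewrite !big_nil.
by rewrite !big_cons -IH.
Qed.
Lemma homm_comp_fin f :
  exists s : seq int, uniq s && (f == \sum_(n <- s) homm_comp n f).
Proof.
have [_ [s hs]] := asboolW (hommP f); exists (undup s); rewrite undup_uniq /=.
apply/eqP; apply: eq_homm => i x hx; rewrite [RHS]homm_sumE.
under eq_bigr do rewrite (homm_compE _ _ hx).
rewrite -(big_map (fun n => i + n) predT (fun n => algr A n (f x))).
apply: sum_gcomp => [|n ns]; first by rewrite map_inj_uniq ?undup_uniq //; exact: addrI.
rewrite -[n](subrK i) addrC; apply: (hs _ _ _ _ hx).
apply: contra ns => ns; apply/mapP; exists (n - i); rewrite ?mem_undup //.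
by rewrite addrC subrK.
Qed.
Definition homm_grading := Grading homm_compB homm_compK homm_comp_fin.

Lemma homm_mgrZ m n (a : gr_opp A) f : a \in homog (algr (gr_opp A)) m ->
  f \in homog homm_grading n -> a *: f \in homog homm_grading (m + n).
Proof.
move=> ha /eqP hf; apply/eqP; apply: eq_homm => i x hx.
have e : f x = algr A (i + n) (f x) by rewrite -{1}hf; exact: homm_compE.
rewrite [LHS](homm_compE _ _ hx) -[(a *: f) x]/((f x : A) * (a : A)) e.
have h : algr A (i + n) (f x) \in homog (algr A) (i + n) by exact: gcomp_in.
by apply/eqP; rewrite [m + n]addrC addrA; exact: (algrM h ha).
Qed.
Definition gr_Hom : grmod (gr_opp A) := @GrMod k (gr_opp A) homm homm_grading homm_mgrZ.

End HomModule.

Section Ext.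
Variables (k : fieldType) (A : gralg k).

Section Precomp.
Variables (M N : grmod A) (d : grhom M N).

Lemma precomp_subproof (f : gr_Hom N) : (fun x => (f : homm N) (d x)) \in @hom_pred k A M.
Proof.
apply/asboolP; split=> [a x y|]; first by rewrite linearP homm_lin.
have [_ [s hs]] := asboolW (hommP f); exists s => n ns i x /eqP hx.
by apply: hs => //; rewrite homogE -ghomC hx.
Qed.
Definition precomp_fun (f : gr_Hom N) : gr_Hom M := Homm (precomp_subproof f).
Lemma precomp_linear : linear precomp_fun.
Proof. by move=> a f g; apply: val_inj. Qed.
HB.instance Definition _ :=
  GRing.isLinear.Build (gr_opp A) (gr_Hom N) (gr_Hom M) _ precomp_fun precomp_linear.
Lemma precompC n f : precomp_fun (mgr (gr_Hom N) n f) = mgr (gr_Hom M) n (precomp_fun f).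
Proof.
apply: eq_homm => i x hx; rewrite [RHS](homm_compE _ _ hx).
have hdx : d x \in homog (mgr N) i by rewrite homogE -ghomC (eqP hx).
exact: (homm_compE n f hdx).
Qed.
Definition precomp : grhom (gr_Hom N) (gr_Hom M) := @GrHom k (gr_opp A) _ _ precomp_fun precompC.
End Precomp.

Variables (M : grmod A) (P : proj_resolution M).

Definition cocycles (i : nat) : gsub (gr_Hom (P i)) := gker (precomp (pr_diff P i)).
Definition coboundaries (i : nat) : gsub (gr_Hom (P i)) :=
  if i is j.+1 then gim (precomp (pr_diff P j)) else gzero (gr_Hom (P 0)).

(* The graded module Ext^i_A(M, A), computed from the graded projective
   resolution P of M. *)
Definition gr_Ext (i : nat) : grmod (gr_opp A) :=
  gquot (grestr (cocycles i) (coboundaries i)).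

End Ext.

Definition projective (R : pzRingType) (P : lmodType R) :=
  forall (M N : lmodType R) (p : {linear M -> N}) (f : {linear P -> N}),
  (forall y, exists x, p x = y) -> exists h : {linear P -> M}, forall x, p (h x) = f x.

Section ASGorenstein.
Variables (k : fieldType) (B : gralg k).
(* Right B-modules are modules over gr_opp B: regmod (gr_opp B) is B_B and
   Smod (gr_opp B) is S_B, while piece (gr_opp B) i is B_i as a right S-module. *)

(* Ext^i_A(S, A) = 0 for i <> d and Ext^d_A(S, A) = D(S)(l) as graded modules
   over gr_opp A.  Ext does not depend on the projective resolution up to graded
   isomorphism, so the condition may be imposed on all of them. *)
Definition Ext_condition (A : gralg k) (d : nat) (l : int) :=
  forall P : proj_resolution (Smod A),
    (forall i, i <> d -> forall e : gr_Ext P i, e = 0) /\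
    gr_iso (gr_Ext P d) (gr_shift (dualS A) l).

Definition AS_Gorenstein (d : nat) (l : int) :=
  [/\ injdim_eq (regmod (gr_opp B)) d, injdim_eq (regmod B) d,
      Ext_condition (gr_opp B) d l & Ext_condition B d l].

Definition Koszul :=
  [/\ forall i : nat, (0 < i)%N -> projective (piece B i),
      forall i : nat, (0 < i)%N -> projective (piece (gr_opp B) i) &
      exists P : proj_resolution (Smod (gr_opp B)),
        forall n : nat, generated_in_degree (P n) n].

(* l is the Gorenstein parameter. *)
Definition standard_Koszul_AS_Gorenstein (d : nat) :=
  exists l : int, [/\ AS_Gorenstein d l, Koszul & l = d].

End ASGorenstein.

(* Main.v *)
From HB Require Import structures.
Require Import Defs.
From mathcomp Require Import all_boot all_order all_algebra.
From mathcomp Require Import generic_quotient ring_quotient boolp.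

(** Write A for the opposite algebra of B, so that right B-modules are left
    A-modules, and let P be the linear resolution of S over A given by the
    Koszul property, V_n being the degree n part of P_n.

    Lower bound. If a resolution had length smaller than d, it would compute
    Ext^d = 0, whereas Ext^d = D(S)(d) is nonzero ([pdim_lower_bound]).

    Upper bound for S_B ([lin_vanish]). Linearity makes each V_n finite
    dimensional, so each P_n has a finite dual basis ([lin_dual_basis]). Because
    l = d, the class of e in D(S) is represented by a cocycle f : P_d -> A that
    sends V_d to A_0. Take n > d and v in V_n, and consider the map
    x |-> f(x) v from P_d to P_n. It can be lowered step by step along P down to
    P_0, because Hom(P, A) is exact below d, and raised again, because P is
    exact: so it is null-homotopic, and the homotopy vanishes for degree reasons
    ([cocycle_annihilates]). Hence f(x) v = 0 for all these f and x; a
    coordinate s of v then satisfies e s = 0 for all e in D(S), so s = 0. Thus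
    V_n = 0, and P_n = 0.

    Upper bound for the other side. Now P has length d, and its dual complex is
    a linear resolution, of length d, of the left B-module D(S)
    ([left_dual_linear_resolution]). It remains to pass from D(S) to S. Every
    cochain on P_d is a cocycle, so D(S) is isomorphic to the dual of V_d and is
    a projective S-module; for a finite-dimensional algebra this forces S to be
    a retract of a power of D(S) ([projective_dual_generates]). Such a retract
    inherits a linear resolution of the same length: the corresponding
    idempotent lifts to the terms of the resolution, and the lift is again
    idempotent, because a linear resolution leaves no room for homotopies
    ([linear_resolution_retract]). *)

Set Implicit Arguments.
Unset Strict Implicit.
Unset Printing Implicit Defensive.

Import Order.TTheory GRing.Theory Num.Theory.
Local Open Scope ring_scope.
Local Open Scope quotient_scope.

(** * Finitely spanned vector spaces *)

Section FiniteSpan.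
Variables (k : fieldType) (V : lmodType k).
Implicit Types (s t : seq V) (x y : V).

Fixpoint in_span s x : Prop :=
  if s is y :: s' then exists c : k, in_span s' (x - c *: y) else x = 0.

Lemma in_span_lin s (c : k) x y : in_span s x -> in_span s y -> in_span s (c *: x + y).
Proof.
elim: s x y => [|z s IH] x y /=; first by move=> -> ->; rewrite scaler0 addr0.
move=> [a ha] [b hb]; exists (c * a + b).
rewrite scalerDl -scalerA opprD addrACA -scalerN -scalerDr.
exact: IH.
Qed.

Lemma in_span0 s : in_span s 0.
Proof. by elim: s => //= y s IH; exists 0; rewrite scale0r subr0. Qed.

Lemma in_span_mem s x : x \in s -> in_span s x.
Proof.
elim: s => //= y s IH; rewrite inE => /orP[/eqP->|/IH h].
  by exists 1; rewrite scale1r subrr; exact: in_span0.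
by exists 0; rewrite scale0r subr0.
Qed.

Lemma in_span_sum s (I : Type) (r : seq I) (c : I -> k) (F : I -> V) :
  (forall i, in_span s (F i)) -> in_span s (\sum_(i <- r) c i *: F i).
Proof.
move=> h; elim: r => [|i r IH]; first by rewrite big_nil; exact: in_span0.
by rewrite big_cons; exact: in_span_lin.
Qed.

Lemma in_spanP s x : in_span s x ->
  exists c : nat -> k, x = \sum_(i < size s) c i *: s`_i.
Proof.
elim: s x => [|y s IH] x /=; first by move=> ->; exists (fun=> 0); rewrite big_ord0.
move=> [a /IH[c e]]; exists (fun i => if i is j.+1 then c j else a).
by rewrite big_ord_recl /= -e addrC subrK.
Qed.

(** Eliminate the spanning vectors one at a time: if some w in W involves the
    first one, subtracting multiples of w leaves vectors of W spanned by the
    others. *)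
Lemma subspace_finite_span s (W : V -> Prop) :
  (forall c x y, W x -> W y -> W (c *: x + y)) -> (forall x, W x -> in_span s x) ->
  exists t, (forall x, x \in t -> W x) /\ (forall x, W x -> in_span t x).
Proof.
elim: s W => [|y s IH] W Wlin Ws; first by exists [::].
case: (pselect (exists x c, [/\ W x, c != 0 & in_span s (x - c *: y)])).
  move=> [w [c [Ww c0 hw]]].
  have [|x []//|t [tW Wt]] := IH (fun x => W x /\ in_span s x).
    by move=> a x z [? ?] [? ?]; split; [exact: Wlin | exact: in_span_lin].
  exists (w :: t); split=> [x|x Wx].
    by rewrite inE => /orP[/eqP->//|/tW[]].
  have [a ha] := Ws _ Wx; exists (a / c); apply: Wt; split.
    by rewrite addrC -scaleNr; apply: Wlin.
  have -> : x - (a / c) *: w = - (a / c) *: (w - c *: y) + (x - a *: y).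
    rewrite scalerBr !scaleNr scalerA divfK // opprK addrACA.
    by rewrite subrr addr0 addrC.
  exact: in_span_lin.
move=> h; apply: (IH W) => // x Wx; have [a ha] := Ws _ Wx.
have [a0|a0] := eqVneq a 0; first by rewrite a0 scale0r subr0 in ha.
by case: h; exists x, a.
Qed.

End FiniteSpan.

Lemma in_span_row (k : fieldType) n (u : 'rV[k]_n) :
  in_span [seq delta_mx 0 i | i <- enum 'I_n] u.
Proof.
rewrite [u]row_sum_delta; apply: in_span_sum => i.
by apply: in_span_mem; apply/mapP; exists i; rewrite ?mem_enum.
Qed.

(** The coordinate map from row vectors onto V has a finitely spanned kernel,
    hence a matrix C with the same kernel; u |-> u C then induces an injection of
    V into row vectors, whose components are the linear coordinates [c]. *)
Lemma exists_basis (k : fieldType) (V : lmodType k) (s : seq V) :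
  (forall x, in_span s x) ->
  exists n (b : 'I_n -> V) (c : 'I_n -> V -> k),
    (forall i a x y, c i (a *: x + y) = a * c i x + c i y) /\
    forall x, x = \sum_i c i x *: b i.
Proof.
move=> hs; pose n := size s.
pose f (u : 'rV[k]_n) := \sum_(i < n) u 0 i *: s`_i.
have fL a u v : f (a *: u + v) = a *: f u + f v.
  rewrite /f scaler_sumr -big_split; apply: eq_bigr => i _.
  by rewrite !mxE scalerDl scalerA.
have f0 : f 0 = 0 by rewrite /f big1 // => i _; rewrite mxE scale0r.
have fB u v : f (u - v) = f u - f v.
  by rewrite [u - v]addrC -[- v]scaleN1r fL scaleN1r addrC.
have fM m (w : 'rV_m) (M : 'M_(m, n)) : f (w *m M) = \sum_i w 0 i *: f (row i M).
  rewrite mulmx_sum_row; elim/big_rec2: _ => // i x u _ <-.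
  by rewrite fL.
have [||t [t0 tP]] := @subspace_finite_span _ _ [seq delta_mx 0 i | i <- enum 'I_n]
  (fun u => f u = 0).
- by move=> c x y hx hy; rewrite fL hx hy scaler0 addr0.
- by move=> x _; exact: in_span_row.
(* The kernel of f is the row space of M, hence the kernel of u |-> u C. *)
pose M := \matrix_(i < size t) t`_i; pose C := cokermx M.
have kerP u : u *m C = 0 <-> f u = 0.
  split=> [/eqP|/tP/in_spanP[c ->]].
    rewrite -submxE => /submxP[D ->]; rewrite fM big1 // => i _.
    by rewrite rowK t0 ?scaler0 //; apply: mem_nth.
  rewrite mulmx_suml big1 // => i _; rewrite -scalemxAl.
  have -> : t`_i = row i M by rewrite rowK.
  by rewrite -row_mul mulmx_coker row0 scaler0.
have hu x : exists u, f u = x.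
  have [c ->] := in_spanP (hs x); exists (\row_i c i).
  by apply: eq_bigr => i _; rewrite mxE.
have [u uK] := choice hu.
exists n, (fun i => f (row i (pinvmx C))), (fun i x => (u x *m C) 0 i); split.
  move=> i a x y; have /eqP : (u (a *: x + y) - (a *: u x + u y)) *m C = 0.
    by apply/kerP; rewrite fB fL !uK subrr.
  by rewrite mulmxBl subr_eq0 => /eqP->; rewrite mulmxDl -scalemxAl !mxE.
move=> x; rewrite -fM -{1}[x]uK; apply/eqP; rewrite -subr_eq0 -fB; apply/eqP/kerP.
by rewrite mulmxBl mulmxKpV ?subrr // submxMl.
Qed.

(** Apply [subspace_finite_span] to the image of W and choose preimages. *)
Lemma finite_span_pullback (k : fieldType) (V V' : lmodType k) (f : V -> V') (W : V -> Prop) t :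
  (forall c x y, f (c *: x + y) = c *: f x + f y) ->
  W 0 -> (forall c x y, W x -> W y -> W (c *: x + y)) ->
  (forall x, W x -> f x = 0 -> x = 0) ->
  (forall x, W x -> in_span t (f x)) ->
  exists t', (forall x, x \in t' -> W x) /\ (forall x, W x -> in_span t' x).
Proof.
move=> fL W0 WL finj ft.
have f0 : f 0 = 0 by have := fL (-1) 0 0; rewrite scaler0 addr0 scaleN1r addNr.
have [||s [sW Ws]] := @subspace_finite_span _ _ t (fun y => exists2 x, W x & f x = y).
- by move=> c _ _ [x Wx <-] [y Wy <-]; exists (c *: x + y); [exact: WL | exact: fL].
- by move=> _ [x Wx <-]; exact: ft.
have /fin_all_exists2[g gW gs] (i : 'I_(size s)) : exists2 x, W x & f x = s`_i.
  by apply: sW; exact: mem_nth.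
have gL (c : nat -> k) : W (\sum_(i < size s) c i *: g i) /\
    f (\sum_(i < size s) c i *: g i) = \sum_(i < size s) c i *: s`_i.
  elim/big_rec2: _ => [|i y z _ [hz1 hz2]]; first by rewrite f0.
  by split; [exact: WL | rewrite fL gs hz2].
exists [seq g i | i <- enum 'I_(size s)]; split=> [x /mapP[i _ ->]//|x Wx].
have /in_spanP[c e] : in_span s (f x) by apply: Ws; exists x.
have [Wc fc] := gL c.
suff -> : x = \sum_(i < size s) c i *: g i.
  by apply: in_span_sum => i; apply: in_span_mem; apply: map_f; rewrite mem_enum.
apply/eqP; rewrite -subr_eq0; apply/eqP; apply: finj.
  by rewrite addrC -scaleN1r; exact: WL.
by rewrite addrC -scaleN1r fL fc e scaleN1r addNr.
Qed.

(** * Finite-dimensional algebras with projective dual *)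

Section Trace.
Variables (k : fieldType) (R : algType k).

Definition linear_form (l : R -> k) := forall a x y, l (a *: x + y) = a * l x + l y.
Definition form_mulr (l : R -> k) (t : R) := fun s => l (t * s).
Definition form_mull (c : R) (l : R -> k) := fun s => l (s * c).

Lemma linear_form_mulr l t : linear_form l -> linear_form (form_mulr l t).
Proof. by move=> h a x y; rewrite /form_mulr mulrDr -scalerAr h. Qed.
Lemma linear_form_mull l t : linear_form l -> linear_form (form_mull t l).
Proof. by move=> h a x y; rewrite /form_mull mulrDl -scalerAl h. Qed.

Lemma linear_form0 l : linear_form l -> l 0 = 0.
Proof. by move=> h; have := h (-1) 0 0; rewrite scaler0 addr0 mulN1r addNr. Qed.
Lemma linear_formD l x y : linear_form l -> l (x + y) = l x + l y.
Proof. by move=> h; rewrite -[x]scale1r h mul1r scale1r. Qed.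
Lemma linear_formZ l a x : linear_form l -> l (a *: x) = a * l x.
Proof. by move=> h; rewrite -[a *: x]addr0 h linear_form0 // addr0. Qed.
Lemma linear_form_sum l (I : Type) (r : seq I) (F : I -> R) : linear_form l ->
  l (\sum_(i <- r) F i) = \sum_(i <- r) l (F i).
Proof.
move=> h; elim: r => [|i r IH]; first by rewrite !big_nil linear_form0.
by rewrite !big_cons linear_formD // IH.
Qed.
Lemma linear_form_add l l' : linear_form l -> linear_form l' ->
  linear_form (fun s => l s + l' s).
Proof. by move=> h h' a x y; rewrite h h' mulrDr addrACA. Qed.
Lemma linear_form_zero : linear_form (fun=> 0).
Proof. by move=> a x y; rewrite mulr0 addr0. Qed.

(** The elements of Hom_R(D(R), R), where D(R) is a right R-module by [form_mulr]. *)
Record dual_hom (q : (R -> k) -> R) : Prop := DualHom {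
  dual_homD : forall l l', linear_form l -> linear_form l' ->
    q (fun s => l s + l' s) = q l + q l';
  dual_homM : forall l t, linear_form l -> q (form_mulr l t) = q l * t }.

Lemma dual_hom0 q : dual_hom q -> q (fun=> 0) = 0.
Proof.
move=> h; rewrite -[RHS](mulr0 (q (fun=> 0))) -(dual_homM h); last exact: linear_form_zero.
by congr q; apply/funext => s.
Qed.
Lemma dual_homZ q a l : dual_hom q -> linear_form l -> q (fun s => a * l s) = a *: q l.
Proof.
move=> hq hl; rewrite -[RHS]mulr1 -scalerAl scalerAr -(dual_homM hq) //.
by congr q; apply/funext => s; rewrite /form_mulr -scalerAl mul1r linear_formZ.
Qed.
Lemma dual_hom_sum q (I : Type) (r : seq I) (F : I -> R -> k) : dual_hom q ->
  (forall i, linear_form (F i)) ->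
  linear_form (fun s => \sum_(i <- r) F i s) /\
  q (fun s => \sum_(i <- r) F i s) = \sum_(i <- r) q (F i).
Proof.
move=> hq hF; elim: r => [|i r [IH1 IH2]].
  rewrite big_nil; under eq_fun do rewrite big_nil.
  by split; [exact: linear_form_zero | exact: dual_hom0].
rewrite big_cons; under eq_fun do rewrite big_cons.
by rewrite -IH2 -dual_homD //; split => //; exact: linear_form_add.
Qed.
Lemma dual_hom_mull q t : dual_hom q -> dual_hom (fun l => t * q l).
Proof.
by move=> h; split=> [l l' hl hl'|l u hl]; rewrite ?(dual_homD h) ?(dual_homM h) ?mulrDr ?mulrA.
Qed.

(** The sum of the images of I D(R) under all homomorphisms D(R) -> R; if I is
    the whole of R, it is the trace ideal of the right module D(R). *)
Inductive trace_ideal (I : R -> Prop) : R -> Prop :=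
| trace_ideal0 : trace_ideal I 0
| trace_idealS c l q x : I c -> linear_form l -> dual_hom q -> trace_ideal I x ->
    trace_ideal I (q (form_mull c l) + x).

Lemma trace_idealD I x y : trace_ideal I x -> trace_ideal I y -> trace_ideal I (x + y).
Proof.
elim=> [|c l q z Ic hl hq _ IH] hy; first by rewrite add0r.
by rewrite -addrA; apply: trace_idealS => //; exact: IH.
Qed.
Lemma trace_ideal_mull I t x : trace_ideal I x -> trace_ideal I (t * x).
Proof.
elim=> [|c l q z Ic hl hq _ IH]; first by rewrite mulr0; exact: trace_ideal0.
by rewrite mulrDr; apply: (trace_idealS Ic hl (dual_hom_mull t hq)).
Qed.
Lemma trace_ideal_mulr I t x : trace_ideal I x -> trace_ideal I (x * t).
Proof.
elim=> [|c l q z Ic hl hq _ IH]; first by rewrite mul0r; exact: trace_ideal0.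
rewrite mulrDl -(dual_homM hq); last exact: linear_form_mull.
have -> : form_mulr (form_mull c l) t = form_mull c (form_mulr l t).
  by apply/funext => s; rewrite /form_mulr /form_mull mulrA.
by apply: trace_idealS => //; exact: linear_form_mulr.
Qed.
Lemma trace_ideal_mono (I I' : R -> Prop) x : (forall y, I y -> I' y) ->
  trace_ideal I x -> trace_ideal I' x.
Proof.
move=> h; elim=> [|c l q z Ic hl hq _ IH]; first exact: trace_ideal0.
by apply: trace_idealS => //; exact: h.
Qed.

Record two_sided (K : R -> Prop) : Prop := TwoSided {
  two_sided0 : K 0; two_sidedD : forall x y, K x -> K y -> K (x + y);
  two_sided_l : forall t x, K x -> K (t * x); two_sided_r : forall t x, K x -> K (x * t) }.

Lemma trace_idealP I : two_sided (trace_ideal I).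
Proof.
split; first exact: trace_ideal0.
- exact: trace_idealD.
- exact: trace_ideal_mull.
- exact: trace_ideal_mulr.
Qed.

(** The subspace K D(R) of D(R). *)
Inductive ideal_form (K : R -> Prop) : (R -> k) -> Prop :=
| ideal_form0 : ideal_form K (fun=> 0)
| ideal_formS d l0 l : K d -> linear_form l0 -> ideal_form K l ->
    ideal_form K (fun s => l0 (s * d) + l s).

Lemma ideal_formD K l l' : ideal_form K l -> ideal_form K l' ->
  ideal_form K (fun s => l s + l' s).
Proof.
elim=> [|d l0 l1 Kd hl0 _ IH] h'.
  by have -> : (fun s => 0 + l' s) = l' by apply/funext => s; rewrite add0r.
under eq_fun do rewrite -addrA; apply: (ideal_formS Kd hl0); exact: IH.
Qed.

Variables (n : nat) (b : 'I_n -> R) (c : 'I_n -> R -> k).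
Hypotheses (cL : forall i, linear_form (c i)) (cb : forall x, x = \sum_i c i x *: b i).

Lemma linear_form_sep x y : (forall l, linear_form l -> l x = l y) -> x = y.
Proof. by move=> h; rewrite [x]cb [y]cb; apply: eq_bigr => i _; rewrite h. Qed.

(** The form g |-> l(q(g)) on D(R) is evaluation at an element, because R is
    reflexive as a vector space. So every endomorphism g |-> l q(g) of the right
    module D(R) is multiplication by an element of R. *)
Lemma dual_hom_eval l q : linear_form l -> dual_hom q ->
  exists e, forall g t, linear_form g -> l (q g * t) = g (t * e).
Proof.
(* The coordinates [c] form the basis of D(R) dual to [b]. *)
move=> hl hq; pose e := \sum_i l (q (c i)) *: b i; exists e.
have h g : linear_form g -> l (q g) = g e.
  move=> hg; rewrite (linear_form_sum _ _ hg).
  have {1}-> : g = (fun s => \sum_i g (b i) * c i s).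
    apply/funext => s; rewrite {1}[s]cb (linear_form_sum _ _ hg).
    by apply: eq_bigr => i _; rewrite linear_formZ // mulrC.
  have [|_ ->] := dual_hom_sum (index_enum 'I_n) (F := fun i s => g (b i) * c i s) hq.
    by move=> i a x y; rewrite cL mulrDr mulrCA.
  rewrite (linear_form_sum _ _ hl); apply: eq_bigr => i _.
  by rewrite dual_homZ // !linear_formZ // mulrC.
by move=> g t hg; rewrite -(dual_homM hq) // h //; exact: linear_form_mulr.
Qed.

(* A dual basis (h, q) of D(R), expressing that this right module is
   projective. *)
Variables (m : nat) (h : 'I_m -> R -> k) (q : 'I_m -> (R -> k) -> R).
Hypotheses (hL : forall j, linear_form (h j)) (qL : forall j, dual_hom (q j)).
Hypothesis hq : forall l, linear_form l -> forall t, l t = \sum_j h j (q j l * t).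

(** If x is a sum of values p(d l0) with d in K, then the form l x, that is
    t |-> l (x t), is the corresponding sum of the forms l p(d l0) = e d l0, where
    e is the element by which the endomorphism l p acts; and e d is in K. *)
Lemma ideal_form_trace K l x : two_sided K -> linear_form l -> trace_ideal K x ->
  ideal_form K (fun t => l (x * t)).
Proof.
move=> hK hl; elim=> [|d l0 p y Kd hl0 hp _ IH].
  have -> : (fun t => l (0 * t)) = fun=> 0.
    by apply/funext => t; rewrite mul0r linear_form0.
  exact: ideal_form0.
have [e he] := dual_hom_eval hl hp.
have -> : (fun t => l ((p (form_mull d l0) + y) * t)) =
    fun t => l0 (t * (e * d)) + l (y * t).
  apply/funext => t; rewrite mulrDl linear_formD // he; last exact: linear_form_mull.
  by rewrite /form_mull mulrA.
by apply: ideal_formS => //; exact: (two_sided_l hK).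
Qed.

Lemma ideal_form_eval K l p : two_sided K -> dual_hom p -> ideal_form K l ->
  exists2 d, K d & forall g t, linear_form g -> l (p g * t) = g (t * d).
Proof.
move=> hK hp; elim=> [|d l0 l1 Kd hl0 _ [d1 Kd1 h1]].
  by exists 0; [exact: two_sided0 | move=> g t hg; rewrite mulr0 linear_form0].
have [e he] := dual_hom_eval hl0 hp; exists (d * e + d1).
  by apply: (two_sidedD hK) => //; exact: (two_sided_r hK).
by move=> g t hg; rewrite -mulrA he // h1 // mulrDr linear_formD // mulrA.
Qed.

(** The ideal L can be recovered from its trace ideal K: K determines the
    submodule L D(R) = D(R) K, and L consists of the elements that map D(R) into
    L D(R), since D(R) is projective with endomorphism ring R. The lemma is the
    resulting implication from K <= trace K to L <= K. *)
Lemma trace_ideal_reflects_le L : let K := trace_ideal L in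
  (forall x, K x -> trace_ideal K x) -> forall x, L x -> K x.
Proof.
move=> K hK s Ls; have iK : two_sided K by exact: trace_idealP.
(* h j q j acts on D(R) as multiplication by an element e j, and the e j sum
   to 1, as (h, q) is a dual basis. The claim is that s (e j) is in K. *)
have key j : exists2 d, K d & forall g t, linear_form g -> h j (q j g * t * s) = g (t * d).
  apply: (@ideal_form_eval K (fun t => h j (t * s))) => //.
  have hl : linear_form (form_mull s (h j)) by exact: linear_form_mull.
  have -> : (fun t => h j (t * s)) = fun t => \sum_i h i (q i (form_mull s (h j)) * t).
    by apply/funext => t; exact: hq hl t.
  elim: index_enum => [|i r IH].
    by under eq_fun do rewrite big_nil; exact: ideal_form0.
  under eq_fun do rewrite big_cons.
  apply: ideal_formD => //; apply: ideal_form_trace => //.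
  apply: hK; rewrite -[q i _]addr0; apply: trace_idealS => //; exact: trace_ideal0.
have [d Kd hd] := fin_all_exists2 key.
suff -> : s = \sum_j d j.
  by elim/big_ind: _ => //; [exact: two_sided0 | exact: two_sidedD].
apply: linear_form_sep => g hg; rewrite (hq hg) (linear_form_sum _ _ hg).
by apply: eq_bigr => j _; rewrite -[q j g]mulr1 hd // mul1r.
Qed.

Fixpoint trace_iter i : R -> Prop :=
  if i is j.+1 then trace_ideal (trace_iter j) else fun=> True.

Lemma trace_iter_le i j x : (i <= j)%N -> trace_iter j x -> trace_iter i x.
Proof.
move=> /subnK <-; elim: (j - i)%N x => // e IH x; rewrite addSn => hx; apply: IH.
move: (e + i)%N x hx => a; elim: a => [|a IHa] x hx; first exact: Logic.I.
by apply: trace_ideal_mono hx => y; exact: IHa.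
Qed.

(** Otherwise R > trace R > trace (trace R) > ... by [trace_ideal_reflects_le],
    an infinite strictly decreasing chain of ideals. Choosing one element in each
    gap of the chain gives arbitrarily many linearly independent elements of R. *)
Lemma trace_ideal1 : trace_ideal (fun=> True) 1.
Proof.
apply/notP => n1.
have strict i : exists x, trace_iter i x /\ ~ trace_iter i.+1 x.
  elim: i => [|i [x [xi xni]]]; first by exists 1.
  apply/notP => hn; apply: xni; apply: (@trace_ideal_reflects_le (trace_iter i)) => //.
  move=> y yi; apply/notP => hy; apply: hn; by exists y.
have [x hx] := choice strict.
(* n + 1 elements of an n-dimensional space are linearly dependent. *)
pose M := \matrix_(i < n.+1, j < n) c j (x i).
have /rowV0Pn[u /sub_kermxP uM u0] : kermx M != 0.
  rewrite -mxrank_eq0 mxrank_ker -lt0n subn_gt0 ltnS; exact: rank_leq_col.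
have sum0 : \sum_i u 0 i *: x i = 0.
  apply: linear_form_sep => l hl; rewrite linear_form0 // (linear_form_sum _ _ hl).
  transitivity (\sum_j (u *m M) 0 j * l (b j)); last first.
    by rewrite uM big1 // => j _; rewrite mxE mul0r.
  under [RHS]eq_bigr do rewrite mxE mulr_suml.
  rewrite exchange_big; apply: eq_bigr => i _ /=.
  rewrite {1}[x i]cb scaler_sumr (linear_form_sum _ _ hl); apply: eq_bigr => j _.
  by rewrite !mxE !linear_formZ // mulrA.
have /rV0Pn[i0 ui0] := u0.
case: (@arg_minnP _ i0 (fun i => u 0 i != 0) (fun i : 'I_n.+1 => i : nat) ui0) => i ui imin.
case: (hx i) => _; apply.
(* i is the first index in a relation, so x i is a combination of later terms,
   all of which lie in the next ideal of the chain. *)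
have -> : x i = (- (u 0 i)^-1)%:A * (\sum_(j | j != i) u 0 j *: x j).
  move: sum0; rewrite (bigD1 i) //= => /eqP; rewrite addr_eq0 => /eqP e.
  by rewrite -scalerAl mul1r scaleNr -scalerN -e scalerA mulVf // scale1r.
apply: trace_ideal_mull; elim/big_ind: _ => [||j ji].
- exact: trace_ideal0.
- exact: trace_idealD.
have [->|uj] := eqVneq (u 0 j) 0; first by rewrite scale0r; exact: trace_ideal0.
rewrite -[x j]mul1r scalerAl; apply: trace_ideal_mull.
apply: (@trace_iter_le i.+1 j); last by case: (hx j).
by rewrite ltn_neqAle imin // andbT eq_sym.
Qed.

(** R is a retract of a power of D(R): the forms [l i] define R -> D(R)^N by
    t |-> (l i t), and the homomorphisms [p i] define a retraction onto R. *)
Lemma projective_dual_generates :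
  exists N (l : 'I_N -> R -> k) (p : 'I_N -> (R -> k) -> R),
  [/\ forall i, linear_form (l i), forall i, dual_hom (p i) & \sum_i p i (l i) = 1].
Proof.
have : trace_ideal (fun=> True) 1 by exact: trace_ideal1.
elim=> [|d l0 p0 x _ hl0 hp0 _ [N [l [p [hl hp hx]]]]].
  exists 0, (fun _ _ => 0), (fun _ _ => 0).
  by split; [case | case | rewrite big_ord0].
exists N.+1, (fun i => if unlift ord0 i is Some j then l j else form_mull d l0),
  (fun i => if unlift ord0 i is Some j then p j else p0); split.
- by move=> i; case: unliftP => [j|] _ //; exact: linear_form_mull.
- by move=> i; case: unliftP.
- rewrite big_ord_recl unlift_none -hx; congr (_ + _).
  by apply: eq_bigr => i _; rewrite liftK.
Qed.
End Trace.

(** * Graded modules: scalars, morphisms, powers, generation *)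

Section Gr.
Variables (k : fieldType) (A : gralg k).
Implicit Types M N : grmod A.

(** M as a vector space, through the structure map k -> A. *)
Definition scalar_mod (M : lmodType A) : Type := M.
Section Kmod.
Variable M : lmodType A.
HB.instance Definition _ := GRing.Zmodule.on (scalar_mod M).
Definition scalar_mod_scale (c : k) (x : scalar_mod M) : scalar_mod M := (c%:A : A) *: (x : M).
Lemma scalar_mod_scaleA c d x :
  scalar_mod_scale c (scalar_mod_scale d x) = scalar_mod_scale (c * d) x.
Proof. by rewrite /scalar_mod_scale scalerA -scalerAl mul1r scalerA. Qed.
Lemma scalar_mod_scale1 : left_id 1 scalar_mod_scale.
Proof. by move=> x; rewrite /scalar_mod_scale !scale1r. Qed.
Lemma scalar_mod_scaleDr : right_distributive scalar_mod_scale +%R.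
Proof. by move=> c x y; rewrite /scalar_mod_scale scalerDr. Qed.
Lemma scalar_mod_scaleDl x : {morph scalar_mod_scale^~ x : c d / c + d}.
Proof. by move=> c d; rewrite /scalar_mod_scale !scalerDl. Qed.
HB.instance Definition _ := GRing.Zmodule_isLmodule.Build k (scalar_mod M)
  scalar_mod_scaleA scalar_mod_scale1 scalar_mod_scaleDr scalar_mod_scaleDl.
Lemma scalar_mod_scalel (c : k) (a : A) (x : M) :
  (c *: a) *: x = (c *: (a *: x : scalar_mod M) : scalar_mod M).
Proof. by rewrite -[RHS]/(c%:A *: (a *: x)) scalerA -scalerAl mul1r. Qed.
Lemma scalar_mod_scaler (c : k) (a : A) (x : scalar_mod M) :
  a *: (c *: x : M) = (c *: (a *: (x : M) : scalar_mod M) : scalar_mod M).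
Proof. by rewrite -[c *: x]/(c%:A *: (x : M)) scalerA -scalerAr mulr1 scalar_mod_scalel. Qed.
End Kmod.

Lemma homogD (V : zmodType) (g : grading V) n x y :
  x \in homog g n -> y \in homog g n -> x + y \in homog g n.
Proof. by rewrite !homogE => /eqP hx /eqP hy; rewrite raddfD /= hx hy. Qed.
Lemma homogB (V : zmodType) (g : grading V) n x y :
  x \in homog g n -> y \in homog g n -> x - y \in homog g n.
Proof. by rewrite !homogE => /eqP hx /eqP hy; rewrite raddfB /= hx hy. Qed.
Lemma homog_0 (V : zmodType) (g : grading V) n : 0 \in homog g n.
Proof. by rewrite homogE raddf0. Qed.
Lemma homog_sum (V : zmodType) (g : grading V) n (I : Type) (r : seq I) (F : I -> V) :
  (forall i, F i \in homog g n) -> \sum_(i <- r) F i \in homog g n.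
Proof. by move=> h; elim/big_ind: _ => //; [exact: homog_0 | move=> *; exact: homogD]. Qed.

Lemma kscale_homog M n (c : k) x :
  x \in homog (mgr M) n -> (c%:A : A) *: x \in homog (mgr M) n.
Proof. by move=> hx; rewrite -[n]add0r; apply: mgrZ => //; apply: homogZ; exact: algr1. Qed.

Lemma mgr_scale_homog M n i (a : A) x : x \in homog (mgr M) n ->
  mgr M i (a *: x) = algr A (i - n) a *: x.
Proof.
move=> hx; elim/(homog_ind (g := algr A)): a => [|a b ha hb|m a ha].
- by rewrite scale0r !raddf0 scale0r.
- by rewrite scalerDl !raddfD /= ha hb scalerDl.
rewrite (gcomp_homog _ (mgrZ ha hx)) (gcomp_homog _ ha) subr_eq.
by case: eqP; rewrite ?scale0r.
Qed.

Section MkGrhom.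
Variables (M N : grmod A) (f : M -> N).
Hypothesis lf : linear f.
Hypothesis hf : forall n x, x \in homog (mgr M) n -> f x \in homog (mgr N) n.
HB.instance Definition _ := GRing.isLinear.Build A M N _ f lf.
Lemma mk_grhomC n x : f (mgr M n x) = mgr N n (f x).
Proof.
elim/(homog_ind (g := mgr M)): x => [|x y hx hy|i x hx].
- by rewrite !raddf0.
- by rewrite !raddfD /= hx hy.
rewrite (gcomp_homog _ hx) (gcomp_homog _ (hf hx)).
by case: eqP; rewrite ?raddf0.
Qed.
Definition mk_grhom : grhom M N := @GrHom k A M N f mk_grhomC.
End MkGrhom.

Lemma mk_grhomE M N f lf hf x : @mk_grhom M N f lf hf x = f x.
Proof. by []. Qed.

Lemma ghom_homog M N (f : grhom M N) n x :
  x \in homog (mgr M) n -> f x \in homog (mgr N) n.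
Proof. by rewrite !homogE -ghomC => /eqP->. Qed.

Section Pow.
Variables (M : grmod A) (m : nat).
Definition pow_comp n (z : {ffun 'I_m -> M}) : {ffun 'I_m -> M} :=
  [ffun i => mgr M n (z i)].
Lemma pow_compB n : zmod_morphism (pow_comp n).
Proof. by move=> x y; apply/ffunP => i; rewrite !ffunE raddfB. Qed.
Lemma pow_compK n p x : pow_comp n (pow_comp p x) = if n == p then pow_comp p x else 0.
Proof. by apply/ffunP => i; rewrite !ffunE gcompK; case: eqP; rewrite ?ffunE. Qed.
Lemma pow_comp_fin x : exists s : seq int, uniq s && (x == \sum_(n <- s) pow_comp n x).
Proof.
pose s := undup (flatten [seq gsupp (mgr M) (x i) | i <- enum 'I_m]).
exists s; rewrite undup_uniq /=; apply/eqP/ffunP => i; rewrite sum_ffunE.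
under eq_bigr do rewrite ffunE; apply: sum_gcomp; first exact: undup_uniq.
move=> n ns; apply: gsupp_out; apply: contra ns => ns; rewrite mem_undup.
by apply/flatten_mapP; exists i; rewrite ?mem_enum.
Qed.
Definition pow_grading := Grading pow_compB pow_compK pow_comp_fin.

Lemma pow_homogP n (z : {ffun 'I_m -> M}) :
  z \in homog pow_grading n <-> forall i, z i \in homog (mgr M) n.
Proof.
split=> [/eqP e i|h]; first by rewrite homogE -{2}e ffunE.
by apply/eqP/ffunP => i; rewrite ffunE; apply/eqP; exact: h.
Qed.
Lemma pow_mgrZ n p (a : A) x : a \in homog (algr A) n -> x \in homog pow_grading p ->
  a *: x \in homog pow_grading (n + p).
Proof. by move=> ha /pow_homogP hx; apply/pow_homogP => i; rewrite ffunE; exact: mgrZ. Qed.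
Definition gr_pow : grmod A := @GrMod k A {ffun 'I_m -> M} pow_grading pow_mgrZ.
End Pow.

Lemma gen_homog_sum M n i x : generated_in_degree M n -> x \in homog (mgr M) i ->
  exists s : seq (A * M),
    (forall p, p \in s -> p.2 \in homog (mgr M) n /\ p.1 \in homog (algr A) (i - n)) /\
    x = \sum_(p <- s) p.1 *: p.2.
Proof.
move=> gM /eqP <-; have [s [hs e]] := gM x; rewrite e => {e}.
exists [seq (algr A (i - n) p.1, p.2) | p <- s]; split=> [p /mapP[q qs ->]|].
  by split; [exact: (hs _ qs) | exact: gcomp_in].
rewrite raddf_sum big_map big_seq [RHS]big_seq; apply: eq_bigr => p ps /=.
by rewrite (mgr_scale_homog _ _ (hs _ ps)).
Qed.

(** In a module generated in degree n nothing lives below n, because A is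
    positively graded. *)
Lemma gen_low M n i x : generated_in_degree M n -> (i < n) -> x \in homog (mgr M) i -> x = 0.
Proof.
move=> gM lt /(gen_homog_sum gM)[s [hs ->]]; rewrite big_seq big1 // => p /hs[_ /eqP <-].
by rewrite algr_pos ?scale0r // subr_lt0.
Qed.

Lemma gen_eq0 M N n (f : M -> N) : linear f -> generated_in_degree M n ->
  (forall x, x \in homog (mgr M) n -> f x = 0) -> forall x, f x = 0.
Proof.
move=> lf gM hf x; have [s [hs ->]] := gM x.
have f0 : f 0 = 0 by have := lf (-1) 0 0; rewrite scaler0 addr0 scaleN1r addNr.
rewrite big_seq; elim/big_rec: _ => // p y /hs h IH.
by rewrite lf hf // scaler0 add0r.
Qed.

Lemma mk_homm M t (f : M -> A) :
  (forall (a : A) x y, f (a *: x + y) = a * f x + f y) ->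
  (forall n x, x \in homog (mgr M) n -> f x \in homog (algr A) (n + t)) ->
  exists2 g : homm M, g \in homog (homm_grading M) t & forall x, g x = f x :> A.
Proof.
move=> lf hf; have h : (f : M -> (gr_opp A)^o) \in @hom_pred k A M.
  apply/asboolP; split=> //; exists [:: t] => i; rewrite inE => it n x /hf hx.
  by rewrite (gcomp_homog _ hx) (inj_eq (addrI n)) (negbTE it).
exists (Homm h) => //; apply/eqP; apply: eq_homm => n x hx.
by rewrite (homm_compE _ _ hx); apply/eqP; exact: hf.
Qed.

(** * Dual bases of the terms of a linear resolution *)

Definition dual_basis M n m (u : 'I_m -> M) (h : 'I_m -> homm M) :=
  [/\ forall j, u j \in homog (mgr M) n,
      forall j, h j \in homog (homm_grading M) (- n)
    & forall x, x = \sum_j (h j x : A) *: u j].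

(** The generators define a surjection from a free module onto M; the components
    of a section of it are the coordinate functions. *)
Lemma exists_dual_basis M n m (u : 'I_m -> M) : gr_projective M ->
  (forall j, u j \in homog (mgr M) n) ->
  (forall x, exists a : 'I_m -> A, x = \sum_j a j *: u j) ->
  exists h, dual_basis n u h.
Proof.
(* The shift by -n puts the basis of the free module in degree n. *)
move=> PM hu gu; pose F := gr_shift (gr_pow (regmod A) m) (- n).
pose p (z : F) := \sum_j ((z : {ffun 'I_m -> A^o}) j : A) *: u j.
have lp : linear p.
  move=> a x y; rewrite /p scaler_sumr -big_split; apply: eq_bigr => j _.
  by rewrite !ffunE scalerDl scalerA.
have hp i x : x \in homog (mgr F) i -> p x \in homog (mgr M) i.
  move=> /pow_homogP hx; apply: homog_sum => j.
  by have := mgrZ (hx j) (hu j); rewrite subrK.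
have [|s hs] := PM F M (mk_grhom lp hp)
  (@mk_grhom M M idfun (fun _ _ _ => erefl) (fun _ _ h => h)).
  move=> x; have [a ->] := gu x; exists ([ffun j => a j] : {ffun 'I_m -> A^o}).
  by apply: eq_bigr => j _; rewrite ffunE.
have /fin_all_exists2[h hh hE] (j : 'I_m) : exists2 g : homm M,
    g \in homog (homm_grading M) (- n) & forall x, g x = (s x : {ffun 'I_m -> A^o}) j :> A.
  apply: mk_homm => [a x y|i x hx]; first by rewrite linearP !ffunE.
  by have /pow_homogP/(_ j) := ghom_homog s hx.
exists h; split=> // x; rewrite -[LHS]hs; apply: eq_bigr => j _; by rewrite hE.
Qed.

Definition fdim M i := exists t : seq (scalar_mod M),
  (forall x, x \in t -> x \in homog (mgr M) i) /\
  (forall x : M, x \in homog (mgr M) i -> in_span t x).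

Lemma fdim_pull M i (V : lmodType k) (f : M -> V) (t : seq V) :
  (forall (c : k) x y, f ((c%:A : A) *: x + y) = c *: f x + f y) ->
  (forall x, x \in homog (mgr M) i -> f x = 0 -> x = 0) ->
  (forall x, x \in homog (mgr M) i -> in_span t (f x)) -> fdim M i.
Proof.
move=> fL finj ft.
apply: (@finite_span_pullback _ (scalar_mod M) V f (fun x => x \in homog (mgr M) i) t) => //.
  exact: homog_0.
by move=> c x y hx hy; apply: homogD => //; exact: kscale_homog.
Qed.

Lemma gen_fdim M n i : generated_in_degree M n -> fdim M n ->
  exists t : seq (scalar_mod M), forall x : M, x \in homog (mgr M) i -> in_span t x.
Proof.
move=> gM [t [tM Mt]]; have [s hs] := algr_fdim A (i - n).
exists [seq (a *: (v : M) : scalar_mod M) | a <- s, v <- t] => x /(gen_homog_sum gM)[r [hr ->]].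
rewrite big_seq; elim/big_ind: _ => [|y z hy hz|p /hr[h2 h1]].
- exact: in_span0.
- by have := in_span_lin (V := scalar_mod M) 1 hy hz; rewrite scale1r.
have [c ->] := hs _ h1; have [d ->] := in_spanP (Mt _ h2).
rewrite scaler_suml.
under eq_bigr => j _ do rewrite scalar_mod_scalel.
apply: (@in_span_sum _ (scalar_mod M)) => j; rewrite scaler_sumr.
under eq_bigr => e _ do rewrite scalar_mod_scaler.
apply: (@in_span_sum _ (scalar_mod M)) => e; apply: in_span_mem.
by apply/allpairsP; exists (s`_j, t`_e); split=> //; exact: mem_nth.
Qed.

Lemma fdim_dual_basis M n : gr_projective M -> generated_in_degree M n -> fdim M n ->
  exists m (u : 'I_m -> M) h, dual_basis n u h.
Proof.
move=> PM gM [t [tM Mt]]; exists (size t), (fun j => t`_j).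
apply: (@exists_dual_basis M n (size t)) => // [j|x]; first by apply: tM; exact: mem_nth.
have [s [hs ->]] := gM x; rewrite big_seq.
elim/big_ind: _ => [|y z [a ->] [b ->]|p /hs /Mt /in_spanP[c ->]].
- by exists (fun=> 0); rewrite big1 // => j _; rewrite scale0r.
- exists (fun j => a j + b j); rewrite -big_split; apply: eq_bigr => j _.
  by rewrite scalerDl.
exists (fun j => p.1 * (c j)%:A); rewrite scaler_sumr; apply: eq_bigr => j _.
by rewrite -[c j *: _]/((c j)%:A *: (t`_j : M)) scalerA.
Qed.

Section Linear.
Variable P : proj_resolution (Smod A).
Hypothesis gP : forall n : nat, generated_in_degree (P n) n.

(** The kernel is the image of P_1, which is generated in degree 1. *)
Lemma lin_aug_inj (x : P 0) : x \in homog (mgr (P 0)) 0 -> pr_aug P x = 0 -> x = 0.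
Proof.
move=> /eqP hx /pr_exact0[y e]; rewrite -hx e -ghomC.
by rewrite (gen_low (gP (n := 1)) (i := 0) (x := mgr _ 0 y)) ?raddf0 ?gcomp_in.
Qed.

Lemma lin_diff_inj n (x : P n.+1) : x \in homog (mgr (P n.+1)) n.+1 ->
  pr_diff P n x = 0 -> x = 0.
Proof.
move=> /eqP hx /pr_exact[y e]; rewrite -hx e -ghomC.
by rewrite (gen_low (gP (n := n.+2)) (i := n.+1) (x := mgr _ _ y)) ?raddf0 ?gcomp_in // ltz_nat.
Qed.

(** By [lin_aug_inj] and [lin_diff_inj] the generators of P_0 embed into A_0,
    and those of P_(n+1) into the degree n+1 part of P_n, which is finite
    dimensional because P_n is generated by a finite-dimensional space. *)
Lemma lin_fdim n : fdim (P n) n.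
Proof.
elim: n => [|n IH].
  have [s hs] := algr_fdim A 0.
  apply: (@fdim_pull _ _ A (fun x => deg0_val (pr_aug P x)) s).
  - move=> c x y; rewrite linearP.
    rewrite -[LHS]/(algr A 0 c%:A * deg0_val (pr_aug P x) + deg0_val (pr_aug P y)).
    by rewrite algrZ (eqP (algr1 A)) -scalerAl mul1r.
  - by move=> x hx e; apply: lin_aug_inj => //; exact: val_inj.
  - move=> x _; have [c ->] := hs _ (deg0P (pr_aug P x)).
    by apply: in_span_sum => j; apply: in_span_mem; exact: mem_nth.
have [t ht] := gen_fdim (n.+1%:Z) (gP (n := n)) IH.
apply: (@fdim_pull _ _ (scalar_mod (P n)) (pr_diff P n) t).
- by move=> c x y; rewrite linearP.
- exact: lin_diff_inj.
- by move=> x hx; apply: ht; exact: ghom_homog.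
Qed.

Lemma lin_dual_basis n : exists m (u : 'I_m -> P n) h, dual_basis n u h.
Proof. by apply: fdim_dual_basis; [exact: pr_proj | exact: gP | exact: lin_fdim]. Qed.

End Linear.
End Gr.

Section Hom.
Variables (k : fieldType) (A : gralg k).
Implicit Types M N L Q : grmod A.

Lemma gr_comp_proof M N L (g : grhom N L) (f : grhom M N) n x :
  (g \o f) (mgr M n x) = mgr L n ((g \o f) x).
Proof. by rewrite /= !ghomC. Qed.
Definition gr_comp M N L (g : grhom N L) (f : grhom M N) : grhom M L :=
  GrHom (gr_comp_proof g f).

Definition gr_shiftf M N (f : grhom M N) c : grhom (gr_shift M c) (gr_shift N c) :=
  @GrHom k A (gr_shift M c) (gr_shift N c) f (fun n x => ghomC f (n + c) x).

Lemma gr_sub_linear M N (f g : grhom M N) : linear (fun x => f x - g x).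
Proof. by move=> a x y; rewrite !linearP scalerDr addrACA. Qed.
Lemma gr_sub_homog M N (f g : grhom M N) n x : x \in homog (mgr M) n ->
  f x - g x \in homog (mgr N) n.
Proof. by move=> hx; apply: homogB; exact: ghom_homog. Qed.
Definition gr_sub M N (f g : grhom M N) : grhom M N :=
  mk_grhom (gr_sub_linear f g) (@gr_sub_homog M N f g).

Lemma corestr_linear M N (U : gsub N) (f : grhom M N) (h : forall x, f x \in gspred U) :
  linear (fun x => Subm (h x) : gsubmod U).
Proof. by move=> a x y; apply: val_inj; rewrite /= linearP. Qed.
Lemma corestr_homog M N (U : gsub N) (f : grhom M N) (h : forall x, f x \in gspred U) n x :
  x \in homog (mgr M) n -> (Subm (h x) : gsubmod U) \in homog (mgr (gsubmod U)) n.
Proof. by move=> hx; apply/eqP/val_inj => /=; apply/eqP; exact: (ghom_homog f hx). Qed.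
Definition corestr M N (U : gsub N) (f : grhom M N) (h : forall x, f x \in gspred U) :
  grhom M (gsubmod U) := mk_grhom (corestr_linear h) (@corestr_homog M N U f h).

(** Lifting along g needs only that the image of g contains that of f: restrict
    the codomain to the image of g. *)
Lemma proj_lift Q L N (g : grhom L N) (f : grhom Q N) : gr_projective Q ->
  (forall x, exists y, g y = f x) -> exists h : grhom Q L, forall x, g (h x) = f x.
Proof.
move=> PQ gf; have hf x : f x \in gspred (gim g).
  by apply/asboolP; have [y <-] := gf x; exists y.
have hg x : g x \in gspred (gim g) by apply/asboolP; exists x.
have [|h hh] := PQ _ _ (corestr hg) (corestr hf).
  move=> [y hy]; have /asboolP[x e] := hy; exists x.
  by apply: val_inj; rewrite /= e.
by exists h => x; have := congr1 val (hh x).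
Qed.

Lemma homm_sum_linear M N m (f : 'I_m -> homm M) (u : 'I_m -> N) :
  linear (fun x => \sum_j (f j x : A) *: u j).
Proof.
move=> a x y; rewrite scaler_sumr -big_split; apply: eq_bigr => j _.
by rewrite homm_lin scalerDl scalerA.
Qed.
Lemma homm_homog M (f : homm M) t n x : f \in homog (homm_grading M) t ->
  x \in homog (mgr M) n -> (f x : A) \in homog (algr A) (n + t).
Proof. by move=> /eqP <- hx; rewrite (homm_compE _ _ hx); exact: gcomp_in. Qed.
Lemma homm_sum_homog M N m (f : 'I_m -> homm M) (u : 'I_m -> N) t s c :
  (forall j, f j \in homog (homm_grading M) t) -> (forall j, u j \in homog (mgr N) s) ->
  t + s = c -> forall n x, x \in homog (mgr M) n ->
  \sum_j (f j x : A) *: u j \in homog (mgr (gr_shift N c)) n.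
Proof.
move=> hf hu <- n x hx; apply: (@homog_sum _ (mgr (gr_shift N (t + s)))) => j.
by have := mgrZ (homm_homog (hf j) hx) (hu j); rewrite -addrA.
Qed.
End Hom.

(** * Ext in terms of cocycles *)

Section ExtElem.
Variables (k : fieldType) (A : gralg k) (P : proj_resolution (Smod A)).

Definition cocycle i (f : homm (P i)) : Prop := forall x, f (pr_diff P i x) = 0.
Definition coboundary i : homm (P i) -> Prop :=
  match i with
  | 0%N => fun f => f = 0
  | j.+1 => fun f => exists g : homm (P j), forall x, f x = g (pr_diff P j x)
  end.

Lemma cocycleP i (f : homm (P i)) : cocycle f <-> f \in gspred (cocycles P i).
Proof.
split=> [h|/eqP h x]; last by have := congr1 (fun g : homm _ => g x) h.
by apply/eqP/val_inj/funext => x; exact: h.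
Qed.
Lemma coboundaryP i (f : homm (P i)) : coboundary f <-> f \in gspred (coboundaries P i).
Proof.
case: i f => [|i] f /=; first by split=> /eqP.
split=> [[g h]|/asboolP[g ->]]; last by exists g.
by apply/asboolP; exists g; apply/val_inj/funext.
Qed.

Definition ext_class i (f : homm (P i)) (h : f \in gspred (cocycles P i)) : gr_Ext P i :=
  \pi_(quotm (grestr (cocycles P i) (coboundaries P i))) (Subm h).

Lemma ext_class0 i (f : homm (P i)) (h : f \in gspred (cocycles P i)) :
  ext_class h = 0 <-> coboundary f.
Proof.
rewrite coboundaryP /ext_class -(pi_quotm0 (grestr (cocycles P i) (coboundaries P i))).
by split=> [/quotmP|hf]; [rewrite subr0 | apply/quotmP; rewrite subr0].
Qed.

Lemma ext_class_surj i (e : gr_Ext P i) : exists f h, e = @ext_class i f h.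
Proof. by rewrite -[e]reprK; case: (repr e) => f h; exists f, h. Qed.

Variables (d : nat) (l : int).
Hypothesis extP : Ext_condition A d l.

(** The isomorphism Ext^d = D(S)(l), read as a map on d-cocycles. As D(S)(l) is
    concentrated in degree -l, homogeneous cocycles of other degrees are
    coboundaries, and every class is represented in degree -l. *)
Lemma ext_dual : exists kap : homm (P d) -> dual A,
  [/\ forall f g, cocycle f -> cocycle g -> kap (f + g) = kap f + kap g,
      forall (a : gr_opp A) f, cocycle f -> kap (a *: f) = a *: kap f,
      forall f, cocycle f -> (kap f = 0 <-> coboundary f),
      forall n f, f \in homog (homm_grading (P d)) n -> cocycle f -> n != - l -> coboundary f
    & forall e, exists f, [/\ cocycle f, f \in homog (homm_grading (P d)) (- l) & kap f = e]].
Proof.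
have [_ [phi [psi phiK psiK]]] := extP P.
pose kap (f : homm (P d)) : dual A :=
  if pselect (f \in gspred (cocycles P d)) is left h then phi (ext_class h) else 0.
have kapE f (h : f \in gspred (cocycles P d)) : kap f = phi (ext_class h).
  by rewrite /kap; case: pselect => // h'; congr (phi (ext_class _)); exact: bool_irrelevance.
have kap0 f : cocycle f -> (kap f = 0 <-> coboundary f).
  move=> /cocycleP h; rewrite kapE -(ext_class0 h); split=> [e|->]; last exact: raddf0.
  by rewrite -[LHS]phiK e -(raddf0 phi) phiK.
have kapC n f : cocycle f -> kap (homm_comp n f) = conc_comp (n + l) (kap f).
  move=> /cocycleP h; have h' : homm_comp n f \in gspred (cocycles P d) by exact: (gs_comp n h).
  rewrite (kapE _ h) (kapE _ h'); have := ghomC phi n (ext_class h) => /= <-.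
  congr (phi _); rewrite /= pi_quotm_comp; congr (\pi_ _ _); exact: val_inj.
exists kap; split=> //.
- move=> f g /cocycleP hf /cocycleP hg; have h : f + g \in gspred (cocycles P d) by exact: rpredD.
  rewrite (kapE _ hf) (kapE _ hg) (kapE _ h) -raddfD; congr (phi _).
  by rewrite /ext_class -pi_quotmD; congr (\pi_ _ _); exact: val_inj.
- move=> a f /cocycleP hf; have h : a *: f \in gspred (cocycles P d) by exact: rpredZ.
  rewrite (kapE _ hf) (kapE _ h) -[RHS](linearZ_LR phi); congr (phi _).
  by rewrite -[RHS]/(quotm_scale _ _) pi_quotmZ; congr (\pi_ _ _); exact: val_inj.
- move=> n f /eqP hf cf nl; apply/(kap0 _ cf); rewrite -hf kapC // /conc_comp.
  by rewrite addr_eq0 (negbTE nl).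
move=> e; have [f [h ef]] := ext_class_surj (psi e).
have cf : cocycle f by apply/cocycleP.
exists (homm_comp (- l) f); split.
- by apply/cocycleP; exact: (gs_comp _ h).
- exact: (gcomp_in (homm_grading (P d))).
- by rewrite kapC // addNr /conc_comp eqxx (kapE _ h) -ef psiK.
Qed.

Lemma ext_exact i (f : homm (P i)) : i != d -> cocycle f -> coboundary f.
Proof.
move=> ne cf; have /cocycleP h := cf; apply/(ext_class0 h).
by have [h1 _] := extP P; apply: h1; apply/eqP.
Qed.

Lemma ext_exact_homog i t (f : homm (P i)) : f \in homog (homm_grading (P i)) t ->
  (i != d) || (t != - l) -> cocycle f -> coboundary f.
Proof.
move=> hf hi cf; have [e|ne] := eqVneq i d; last exact: ext_exact.
have [kap [_ _ _ h _]] := ext_dual.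
rewrite e eqxx /= in hi; move: f hf cf; rewrite e => f hf cf; exact: h hf cf hi.
Qed.

Lemma coboundary_cocycle i (f : homm (P i)) : coboundary f -> cocycle f.
Proof.
case: i f => [|i] f /= => [-> //|[g h] x].
by rewrite h (_ : pr_diff P i _ = 0) ?(homm0 g) //; apply/pr_exact; exists x.
Qed.

Lemma coboundary_homog j t (f : homm (P j.+1)) : f \in homog (homm_grading _) t ->
  coboundary f -> exists2 g : homm (P j), g \in homog (homm_grading _) t &
    forall x, f x = g (pr_diff P j x).
Proof.
move=> /eqP hf [g hg]; exists (homm_comp t g); first exact: (gcomp_in (homm_grading (P j))).
suff -> : f = precomp_fun (pr_diff P j) (homm_comp t g) by [].
rewrite (precompC (pr_diff P j) t g) -[LHS]hf; congr homm_comp.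
exact/val_inj/funext.
Qed.

End ExtElem.

(** * The resolution vanishes beyond d *)

Section Deg0.
Variables (k : fieldType) (A : gralg k).
Lemma deg0_basis : exists n (b : 'I_n -> deg0 A) (c : 'I_n -> deg0 A -> k),
  (forall i, linear_form (c i)) /\ forall x, x = \sum_i c i x *: b i.
Proof.
have [s hs] := algr_fdim A 0.
have [|||||t [_ ht]] := @finite_span_pullback k (deg0 A) A (@deg0_val k A) (fun=> True) s.
- by [].
- by [].
- by [].
- by move=> x _ e; exact: val_inj.
- move=> x _; have [c ->] := hs _ (deg0P x).
  by apply: in_span_sum => j; apply: in_span_mem; exact: mem_nth.
have [n [b [c [h1 h2]]]] := exists_basis (fun x => ht x Logic.I).
by exists n, b, c; split=> // i a x y; exact: h1.
Qed.

Lemma linear_form_dual (l : deg0 A -> k) :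
  linear_form l -> (l : deg0 A -> k^o) \in @dual_pred k A.
Proof. by move=> h; apply/asboolP => a x y; rewrite h. Qed.

Lemma dual_sep (x : deg0 A) : (forall e : dual A, e x = 0) -> x = 0.
Proof.
move=> h; have [n [b [c [cL cb]]]] := deg0_basis.
rewrite [x]cb big1 // => i _; have /= -> := h (Dual (linear_form_dual (cL i))).
by rewrite scale0r.
Qed.

Lemma dual_nonzero : exists e : dual A, e <> 0.
Proof.
apply/notP => h; have : 1 = 0 :> deg0 A.
  by apply: dual_sep => e; have -> : e = 0 by apply/notP => he; apply: h; exists e.
by move/eqP; rewrite oner_eq0.
Qed.
End Deg0.

Section Chase.
Variables (k : fieldType) (A : gralg k) (P : proj_resolution (Smod A)).
Hypothesis gP : forall n : nat, generated_in_degree (P n) n.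
Variable d : nat.
Hypothesis extP : Ext_condition A d d.

(** The coboundaries of Hom(P, N): chi is zero if i = 0, and otherwise factors
    through the differential out of P_i. *)
Definition factors_diff i (N : grmod A) : (P i -> N) -> Prop :=
  match i with
  | 0%N => fun chi => forall x, chi x = 0
  | j.+1 => fun chi => exists th : grhom (P j) N, forall x, chi x = th (pr_diff P j x)
  end.

Arguments factors_diff {i} N chi.

Lemma pr_diffK i x : pr_diff P i (pr_diff P i.+1 x) = 0.
Proof. by apply/pr_exact; exists x. Qed.

Lemma factors_diff0 i (N : grmod A) (chi : P i -> N) : factors_diff N chi ->
  forall x, chi (pr_diff P i x) = 0.
Proof. by case: i chi => [|i] chi //= [th h] x; rewrite h pr_diffK raddf0. Qed.

(** Exactness of Hom(P, A) passes to Hom(P, P_m): compose with the coordinate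
    functions of P_m, and reassemble the resulting primitives. *)
Lemma cocycle_factors_diff i m c (chi : grhom (P i) (gr_shift (P m) c)) :
  (i != d) || (c - m%:Z != - d%:Z) -> (forall x, chi (pr_diff P i x) = 0) ->
  factors_diff (gr_shift (P m) c) chi.
Proof.
move=> hi chi0; have [n [u [h [hu hh hx]]]] := lin_dual_basis gP m.
have /fin_all_exists2[f hf fE] (j : 'I_n) : exists2 g : homm (P i),
    g \in homog (homm_grading _) (c - m%:Z) & forall x, g x = h j (chi x) :> A.
  apply: mk_homm => [a x y|t x xt]; first by rewrite linearP homm_lin.
  have := homm_homog (hh j) (ghom_homog chi xt : (chi x : P m) \in homog (mgr (P m)) (t + c)).
  by rewrite addrA.
have cf j : coboundary (f j).
  apply: (ext_exact_homog extP (hf j) hi) => x; rewrite fE chi0.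
  by rewrite (homm0 (h j)).
have chiE x : chi x = \sum_j (f j x : A) *: u j.
  by rewrite [LHS]hx; apply: eq_bigr => j _; rewrite fE.
case: i chi hi chi0 f hf fE cf chiE => [|i] chi hi chi0 f hf fE cf chiE.
  by move=> x; rewrite chiE big1 // => j _; rewrite (cf j : f j = 0) /= scale0r.
have /fin_all_exists2[g hg gE] j := coboundary_homog (hf j) (cf j).
exists (@mk_grhom _ _ _ (gr_shift (P m) c) _
  (homm_sum_linear g u) (homm_sum_homog hg hu (subrK _ _))) => x.
by rewrite chiE; apply: eq_bigr => j _; rewrite gE.
Qed.

Lemma lift_cycle i m c (phi : grhom (P i) (gr_shift (P m.+1) c)) :
  (forall x, pr_diff P m (phi x) = 0) ->
  exists th : grhom (P i) (gr_shift (P m.+2) c), forall x, pr_diff P m.+1 (th x) = phi x.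
Proof.
move=> h.
have [x|th hth] := @proj_lift _ _ _ _ _ (gr_shiftf (pr_diff P m.+1) c) phi
  (@pr_proj _ _ _ P i).
  by have /pr_exact[y ->] := h x; exists y.
by exists th => x; exact: hth.
Qed.

(** Induction on i, down to P_0. Through d phi = chi d the hypothesis provides a
    map chi on P_(i-1), and d chi is a cocycle of Hom(P, P_(m-1)), which is exact
    at i - 1 < d; so chi satisfies the hypothesis one step lower in both indices.
    The correction th1 found there makes phi - th1 d a cycle, which lifts because
    P_i is projective. *)
Lemma lift_homotopy i m c (phi : grhom (P i) (gr_shift (P m.+1) c)) :
  (i <= m)%N -> (i <= d)%N ->
  factors_diff (gr_shift (P m) c) (fun x => pr_diff P m (phi x)) ->
  exists th : grhom (P i) (gr_shift (P m.+2) c),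
    factors_diff (gr_shift (P m.+1) c) (fun x => phi x - pr_diff P m.+1 (th x)).
Proof.
elim: i m phi => [|i IH] m phi im id fphi.
  have [th h] := lift_cycle fphi.
  by exists th => x; rewrite h subrr.
have [chi hchi] := fphi; case: m im phi fphi chi hchi => // m im phi fphi chi hchi.
have [th1 h1] : exists th1 : grhom (P i) (gr_shift (P m.+2) c),
    factors_diff (gr_shift (P m.+1) c) (fun x => chi x - pr_diff P m.+1 (th1 x)).
  apply: IH => //; first exact: ltnW.
  apply: (@cocycle_factors_diff _ _ _ (gr_comp (gr_shiftf (pr_diff P m) c) chi)).
    by rewrite neq_ltn id.
  by move=> x; rewrite /= -hchi pr_diffK.
have [|th h] := @lift_cycle i.+1 m.+1 c (gr_sub phi (gr_comp th1 (pr_diff P i))).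
  by move=> x; rewrite mk_grhomE raddfB /= hchi; exact: (factors_diff0 h1 x).
exists th; exists th1 => x; by rewrite h mk_grhomE /= subKr.
Qed.

Lemma ghom_low0 i m c (th : grhom (P i) (gr_shift (P m) c)) x :
  i%:Z + c < m%:Z -> th x = 0.
Proof.
move=> lt; apply: (gen_eq0 (f := th) (n := i) _ (gP (n := i))) => [a y z|y hy].
  exact: linearP.
exact: (gen_low (gP (n := m)) lt (ghom_homog th hy)).
Qed.

Lemma factors_diff_low0 i m c (chi : P i -> gr_shift (P m) c) :
  i%:Z + c <= m%:Z -> factors_diff (gr_shift (P m) c) chi -> forall x, chi x = 0.
Proof.
case: i chi => [|i] chi //= le [th h] x; rewrite h; apply: ghom_low0.
by apply: lt_le_trans le; rewrite ltrD2r ltz_nat.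
Qed.

(** The map x |-> f(x) v satisfies the hypothesis of [lift_homotopy], since the
    coordinates of its composite with the differential are cocycles of degree
    1 - d, whereas Ext^d lives in degree -d. Both parts of the homotopy so obtained
    send generators below the degree in which the target is generated, hence
    vanish. *)
Lemma cocycle_annihilates (f : homm (P d)) n (v : P n) : cocycle f ->
  f \in homog (homm_grading _) (- d%:Z) -> v \in homog (mgr (P n)) n -> (d < n)%N ->
  forall x, (f x : A) *: v = 0.
Proof.
move=> cf hf hv dn; case: n v hv dn => // m v hv dm.
have lphi : linear (fun x => (f x : A) *: v).
  by move=> a x y; rewrite homm_lin scalerDl scalerA.
(* The map sends V_d to V_(m+1), so it has degree c. *)
pose c : int := m.+1%:Z - d%:Z.
have hphi n x : x \in homog (mgr (P d)) n ->
    (f x : A) *: v \in homog (mgr (gr_shift (P m.+1) c)) n.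
  move=> hx; have := mgrZ (homm_homog hf hx) hv.
  by rewrite homogE -addrA [- _ + _]addrC.
pose phi : grhom (P d) (gr_shift (P m.+1) c) :=
  @mk_grhom _ _ _ (gr_shift (P m.+1) c) _ lphi hphi.
have [|th hth] := lift_homotopy (phi := phi) dm (leqnn d).
  apply: (@cocycle_factors_diff _ _ _ (gr_comp (gr_shiftf (pr_diff P m) c) phi)).
    apply/orP; right; rewrite /c intS addrAC addrK.
    by rewrite -subr_eq0 opprK subrK.
  by move=> x; rewrite /= (cf x) scale0r raddf0.
have dc : d%:Z + c = m.+1%:Z by rewrite /c addrC subrK.
move=> x; have th0 : th x = 0 by apply: ghom_low0; rewrite dc ltz_nat.
have := factors_diff_low0 (_ : d%:Z + c <= m.+1%:Z) hth x.
by rewrite dc th0 raddf0 subr0; apply.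
Qed.

(** A coordinate s of an element of V_n satisfies f(x) s = 0 for all the cocycles
    f of degree -d, so s annihilates D(S); evaluating forms at s gives s = 0. *)
Lemma lin_vanish n (x : P n) : (d < n)%N -> x = 0.
Proof.
move=> dn; have [m [u [h [hu hh hx]]]] := lin_dual_basis gP n.
have [kap [_ kapZ kap0 _ kapS]] := ext_dual P extP.
suff u0 j : u j = 0 by rewrite [x]hx big1 // => j _; rewrite u0 scaler0.
rewrite [u j]hx big1 // => i _.
have hs : (h i (u j) : A) \in homog (algr A) 0.
  by have := homm_homog (hh i) (hu j); rewrite subrr.
suff s0 : Deg0 hs = 0 by have /= -> := congr1 (@deg0_val k A) s0; rewrite scale0r.
apply: dual_sep => e; have [f [cf hf <-]] := kapS e.
have : (h i (u j) : gr_opp A) *: f = 0.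
  apply/val_inj/funext => y; change ((f y : A) * (h i (u j) : A) = 0).
  by rewrite -hommZ (cocycle_annihilates cf hf (hu j) dn) (homm0 (h i)).
move=> /(congr1 kap); rewrite kapZ // => e0.
have k0 : kap 0 = 0.
  by have := kapZ 0 f cf; rewrite !scale0r.
rewrite k0 in e0; have := congr1 (fun g : dual A => g 1) e0 => /=.
rewrite mulr1 => e1; rewrite -[RHS]e1; congr (kap f _).
by apply: val_inj; rewrite /= (eqP hs).
Qed.
End Chase.

(** * The dual of S is projective over S *)

Section DualProjective.
Variables (k : fieldType) (A : gralg k) (P : proj_resolution (Smod A)).
Hypothesis gP : forall n : nat, generated_in_degree (P n) n.
Variable d : nat.
Hypothesis extP : Ext_condition A d d.

Lemma all_cocycle (f : homm (P d)) : cocycle f.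
Proof. by move=> x; rewrite (lin_vanish gP extP x (leqnn _)) raddf0 (homm0 f). Qed.

Lemma homm_low0 i t (f : homm (P i)) : i%:Z + t < 0 ->
  f \in homog (homm_grading _) t -> f = 0.
Proof.
move=> lt hf; apply: eq_homm => j x _; move: x.
apply: (@gen_eq0 k A (P i) (regmod A) i f) => // [a x y|x hx].
  exact: homm_lin.
by have /eqP <- := homm_homog hf hx; exact: algr_pos.
Qed.

(** A coboundary of degree -d comes from a cochain of degree -d on P_(d-1), which
    sends the generators to A_(-1) = 0. *)
Lemma top_coboundary0 (f : homm (P d)) : f \in homog (homm_grading _) (- d%:Z) ->
  coboundary f -> f = 0.
Proof.
move: f; case: (d) => [|j] f hf; first by [].
move=> /(coboundary_homog hf)[g hg fg].
have g0 : g = 0 by apply: homm_low0 hg; rewrite intS opprD addrCA subrr.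
by apply/val_inj/funext => x; rewrite /= fg g0.
Qed.

(** As P_(d+1) = 0 and coboundaries vanish in degree -d, D(S) is isomorphic to
    the module of degree -d functions on P_d. A dual basis of P_d induces a dual
    basis of that module, so [projective_dual_generates] applies. *)
Lemma dual_deg0_generates :
  exists N (l : 'I_N -> deg0 A -> k) (p : 'I_N -> (deg0 A -> k) -> deg0 A),
  [/\ forall i, linear_form (l i), forall i, dual_hom (p i) & \sum_i p i (l i) = 1].
Proof.
have [kap [kapD' kapZ' kap0' _ kapS]] := ext_dual P extP.
have kapD f g : kap (f + g) = kap f + kap g by apply: kapD'; exact: all_cocycle.
have kapZ (a : gr_opp A) f : kap (a *: f) = a *: kap f by apply: kapZ'; exact: all_cocycle.
have kap_inj f g : f \in homog (homm_grading (P d)) (- d%:Z) ->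
    g \in homog (homm_grading (P d)) (- d%:Z) -> kap f = kap g -> f = g.
  move=> hf hg e; apply/eqP; rewrite -subr_eq0; apply/eqP.
  apply: top_coboundary0; first exact: homogB.
  apply/kap0'; first exact: all_cocycle.
  have -> : f - g = f + ((-1 : gr_opp A) *: g) by rewrite scaleN1r.
  by rewrite kapD kapZ e scaleN1r subrr.
(* F l is the function of degree -d on P_d corresponding to the form l. *)
have FP (l : deg0 A -> k) : exists f : homm (P d), linear_form l ->
    f \in homog (homm_grading (P d)) (- d%:Z) /\ dual_fun (kap f) = l.
  have [h|h] := pselect (linear_form l); last by exists 0.
  by have [f [_ hf e]] := kapS (Dual (linear_form_dual h)); exists f; rewrite e.
have [F hF] := choice FP.
have [m [u [h [hu hh hx]]]] := lin_dual_basis gP d.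
have kfd (e : dual A) : linear_form e by move=> a x y; rewrite dual_linear.
(* F l (u j) has degree d - d, so the projection only changes its type. *)
pose q j l := proj0 (F l (u j) : A).
have dq j : dual_hom (q j).
  split=> [l l' hl hl'|l t hl].
    rewrite /q -proj0D; congr proj0.
    suff -> : F (fun s => l s + l' s) = F l + F l' by [].
    have [h1 e1] := hF _ hl; have [h2 e2] := hF _ hl'.
    have [h3 e3] := hF _ (linear_form_add hl hl').
    apply: kap_inj => //; first exact: homogD.
    apply: val_inj; rewrite kapD /= e3; apply/funext => s.
    by rewrite -[RHS]/(kap (F l) s + kap (F l') s) e1 e2.
  have [h1 e1] := hF _ hl; have [h2 e2] := hF _ (linear_form_mulr t hl).
  have tt : proj0 (t : A) = t by apply: val_inj; apply/eqP; exact: deg0P.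
  suff e : F (form_mulr l t) = (t : gr_opp A) *: F l.
    transitivity (proj0 ((F l (u j) : A) * (t : A))); first by rewrite /q e.
    by rewrite proj0M tt.
  apply: kap_inj => //.
    have := homm_mgrZ (deg0P t : (t : gr_opp A) \in homog (algr (gr_opp A)) 0) h1.
    by rewrite add0r.
  apply: val_inj; rewrite kapZ /= e2; apply/funext => s.
  by rewrite tt e1.
have kap_sum (I : Type) (r : seq I) (f : I -> homm (P d)) :
    kap (\sum_(i <- r) f i) = \sum_(i <- r) kap (f i).
  elim: r => [|i r IH]; last by rewrite !big_cons kapD IH.
  by rewrite !big_nil; apply/kap0' => //; case: (d) => [|j] //=; exists 0.
have [n [b [c [cL cb]]]] := deg0_basis A.
apply: (projective_dual_generates cL cb (h := fun j => dual_fun (kap (h j))) (q := q)) => //.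
move=> l hl t; have [h1 e1] := hF _ hl.
have -> : l t = kap (F l) t by rewrite e1.
have -> : F l = \sum_j (F l (u j) : gr_opp A) *: h j.
  apply: eq_homm => i x _; rewrite [RHS]homm_sumE {1}[x]hx.
  elim/big_rec2: _ => [|j y z _ <-]; first exact: (homm0 (F l)).
  exact: (homm_lin (F l)).
rewrite kap_sum; elim/big_rec2: _ => // j y z _ <-.
by rewrite kapZ.
Qed.

End DualProjective.

(** * Linear resolutions and their retracts *)

Section PowMaps.
Variables (k : fieldType) (A : gralg k).
Implicit Types M N Q X : grmod A.

Section Maps.
Variables (M Q : grmod A) (m : nat).

Lemma pow_tuple_linear (f : 'I_m -> grhom Q M) :
  linear (fun x => [ffun i => f i x] : gr_pow M m).
Proof. by move=> a x y; apply/ffunP => i; rewrite !ffunE linearP. Qed.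
Lemma pow_tuple_homog (f : 'I_m -> grhom Q M) n x : x \in homog (mgr Q) n ->
  ([ffun i => f i x] : gr_pow M m) \in homog (mgr (gr_pow M m)) n.
Proof. by move=> hx; apply/pow_homogP => i; rewrite ffunE; exact: ghom_homog. Qed.
Definition pow_tuple f : grhom Q (gr_pow M m) :=
  mk_grhom (pow_tuple_linear f) (pow_tuple_homog f).

Lemma pow_proj_linear i : linear (fun z : gr_pow M m => (z : {ffun 'I_m -> M}) i).
Proof. by move=> a x y; rewrite !ffunE. Qed.
Definition pow_proj i : grhom (gr_pow M m) M :=
  mk_grhom (pow_proj_linear i) (fun n z hz => (pow_homogP n z).1 hz i).

Lemma pow_sum_linear (f : 'I_m -> grhom M Q) :
  linear (fun z : gr_pow M m => \sum_i f i ((z : {ffun 'I_m -> M}) i)).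
Proof.
move=> a x y; rewrite scaler_sumr -big_split; apply: eq_bigr => i _.
by rewrite !ffunE linearP.
Qed.
Lemma pow_sum_homog (f : 'I_m -> grhom M Q) n (z : gr_pow M m) :
  z \in homog (mgr (gr_pow M m)) n ->
  \sum_i f i ((z : {ffun 'I_m -> M}) i) \in homog (mgr Q) n.
Proof. by move=> /pow_homogP hz; apply: homog_sum => i; exact: ghom_homog. Qed.
Definition pow_sum f : grhom (gr_pow M m) Q :=
  mk_grhom (pow_sum_linear f) (pow_sum_homog f).
End Maps.

Definition gr_id M : grhom M M :=
  @mk_grhom k A M M idfun (fun _ _ _ => erefl) (fun _ _ h => h).

Lemma zero_linear M N : linear (fun _ : M => 0 : N).
Proof. by move=> a x y; rewrite scaler0 addr0. Qed.
Definition gr_zero M N : grhom M N :=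
  mk_grhom (@zero_linear M N) (fun n _ _ => homog_0 (mgr N) n).

Definition pow_inj M m (i : 'I_m) : grhom M (gr_pow M m) :=
  pow_tuple (fun j => if j == i then gr_id M else gr_zero M M).

Lemma pow_injE M m (z : gr_pow M m) : z = \sum_i pow_inj M i ((z : {ffun 'I_m -> M}) i).
Proof.
apply/ffunP => j; rewrite sum_ffunE (bigD1 j) //= ffunE eqxx big1 ?addr0 // => i ij.
by rewrite ffunE eq_sym (negbTE ij).
Qed.

Definition pow_map M N m (f : grhom M N) : grhom (gr_pow M m) (gr_pow N m) :=
  pow_tuple (fun i => gr_comp f (pow_proj M i)).

Lemma pow_projective M m : gr_projective M -> gr_projective (gr_pow M m).
Proof.
move=> PM L N p f ps.
have /fin_all_exists[h hE] (i : 'I_m) : exists h : grhom M L,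
    forall x, p (h x) = f (pow_inj M i x) by exact: PM _ _ p (gr_comp f (pow_inj M i)) ps.
exists (pow_sum h) => z; rewrite mk_grhomE raddf_sum [in RHS](pow_injE z) raddf_sum.
by apply: eq_bigr => i _; exact: hE.
Qed.

Lemma retract_projective X Q (i : grhom X Q) (r : grhom Q X) :
  (forall x, r (i x) = x) -> gr_projective Q -> gr_projective X.
Proof.
move=> ri PQ L N p f ps; have [h hE] := PQ _ _ p (gr_comp f r) ps.
by exists (gr_comp h i) => x; rewrite /= hE /= ri.
Qed.

Definition gen_elt M n (x : M) := exists s : seq (A * M),
  (forall p, p \in s -> p.2 \in homog (mgr M) n) /\ x = \sum_(p <- s) p.1 *: p.2.

Lemma gen_elt_image M N n (f : grhom M N) x : gen_elt n x -> gen_elt n (f x).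
Proof.
move=> [s [hs ->]]; exists [seq (p.1, f p.2) | p <- s]; split.
  by move=> q /mapP[p ps ->]; apply: ghom_homog; exact: hs.
rewrite raddf_sum big_map; apply: eq_bigr => p _; exact: (linearZ_LR f).
Qed.

Lemma gen_elt_sum M n (I : Type) (r : seq I) (F : I -> M) :
  (forall i, gen_elt n (F i)) -> gen_elt n (\sum_(i <- r) F i).
Proof.
move=> h; elim: r => [|i r [t [ht et]]]; first by exists [::]; rewrite !big_nil.
have [s [hs es]] := h i; exists (s ++ t); rewrite big_cons big_cat /= -es -et.
by split=> // p; rewrite mem_cat => /orP[]; [exact: hs | exact: ht].
Qed.

Lemma pow_generated M n m : generated_in_degree M n -> generated_in_degree (gr_pow M m) n.
Proof.
move=> gM z; rewrite [z]pow_injE; apply: (@gen_elt_sum (gr_pow M m)) => i.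
exact: (gen_elt_image (pow_inj M i)) (gM _).
Qed.

Lemma image_generated M N n (f : grhom M N) : (forall y, exists x, f x = y) ->
  generated_in_degree M n -> generated_in_degree N n.
Proof. by move=> fs gM y; have [x <-] := fs y; exact: gen_elt_image (gM x). Qed.

Lemma sub_incl_linear M (U : gsub M) : linear (fun x : gsubmod U => subm_val x).
Proof. by []. Qed.
Lemma sub_incl_homog M (U : gsub M) n (x : gsubmod U) :
  x \in homog (mgr (gsubmod U)) n -> subm_val x \in homog (mgr M) n.
Proof. by move=> /eqP hx; apply/eqP; rewrite -[in RHS]hx. Qed.
Definition sub_incl M (U : gsub M) : grhom (gsubmod U) M :=
  mk_grhom (@sub_incl_linear M U) (@sub_incl_homog M U).

(** A resolution of M of length n whose i-th term is projective and generated in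
    degree j + i, built from its syzygies. Injectivity of the cover in degree j
    makes lifts along it unique on modules generated in degree j. *)
Fixpoint linear_resolution (j : int) (n : nat) M : Prop :=
  exists G (p : grhom G M),
    [/\ gr_projective G, generated_in_degree G j, forall y, exists x, p x = y,
      forall x, x \in homog (mgr G) j -> p x = 0 -> x = 0 &
      match n with
      | 0%N => forall x, p x = 0 -> x = 0
      | n'.+1 => linear_resolution (j + 1) n' (gsubmod (gker p))
      end].

Lemma gkerP M N (f : grhom M N) x : x \in gspred (gker f) <-> f x = 0.
Proof. by split=> [/eqP|/eqP]. Qed.

(** The idempotent of M^m with image X lifts to an endomorphism e of G^m. The
    difference of e e and e maps the generators, of degree j, to the kernel of
    the cover, which is zero in that degree; so e is idempotent too, its image
    covers X, and the kernel of this cover is a retract of the m-th power of the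
    original one. *)
Lemma retract_cover j M X m (al : grhom X (gr_pow M m)) (be : grhom (gr_pow M m) X)
    G (p : grhom G M) : (forall x, be (al x) = x) ->
  gr_projective G -> generated_in_degree G j -> (forall y, exists x, p x = y) ->
  (forall x, x \in homog (mgr G) j -> p x = 0 -> x = 0) ->
  exists G' (p' : grhom G' X),
    [/\ gr_projective G', generated_in_degree G' j, forall y, exists x, p' x = y,
      forall x, x \in homog (mgr G') j -> p' x = 0 -> x = 0 &
      exists (i : grhom (gsubmod (gker p')) (gr_pow (gsubmod (gker p)) m))
        (r : grhom (gr_pow (gsubmod (gker p)) m) (gsubmod (gker p'))),
      forall x, r (i x) = x].
Proof.
move=> bal PG gG ps pj; pose pm := pow_map m p.
have pm0 n x : pm x = 0 -> p ((x : {ffun 'I_m -> G}) n) = 0.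
  by move=> /ffunP/(_ n); rewrite !ffunE.
have pms y : exists x, pm x = y.
  have [g hg] := choice ps.
  by exists ([ffun i => g (y i)] : {ffun 'I_m -> G}); apply/ffunP => i; rewrite !ffunE /= ffunE.
have pmj x : x \in homog (mgr (gr_pow G m)) j -> pm x = 0 -> x = 0.
  move=> /pow_homogP hx /pm0 h; apply/ffunP => i; rewrite ffunE; exact: pj.
have Pm : gr_projective (gr_pow G m) by exact: pow_projective.
have [e ee] := @proj_lift _ _ _ _ _ pm (gr_comp al (gr_comp be pm)) Pm (fun x => pms _).
have eE x : pm (e x) = al (be (pm x)) by exact: ee.
have idem x : e (e x) = e x.
  apply/eqP; rewrite -subr_eq0; apply/eqP; rewrite -[LHS]/(gr_sub (gr_comp e e) e x).
  pose D := gr_sub (gr_comp e e) e.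
  have lD : linear (D : gr_pow G m -> gr_pow G m) by move=> a y z; exact: linearP.
  apply: (gen_eq0 lD (pow_generated (m := m) gG)) => {}x hx.
  apply: pmj; first exact: ghom_homog.
  transitivity (pm (e (e x)) - pm (e x)); first exact: (raddfB pm).
  by rewrite !eE bal subrr.
pose G' := gsubmod (gim e).
have e_in x : e x \in gspred (gim e) by apply/asboolP; exists x.
pose er : grhom (gr_pow G m) G' := corestr e_in.
have eK (z : G') : e (subm_val z) = subm_val z.
  by case: z => z /= /asboolP[x ->]; exact: idem.
have ers (z : G') : er (subm_val z) = z by apply: val_inj; exact: eK.
pose p' : grhom G' X := gr_comp be (gr_comp pm (sub_incl (gim e))).
have p'E z : p' z = be (pm (subm_val z)) by [].
have pmE (z : G') : pm (subm_val z) = al (p' z) by rewrite -[in LHS]eK eE.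
exists G', p'; split.
- exact: (@retract_projective _ _ (sub_incl (gim e)) er ers Pm).
- by apply: (@image_generated _ _ _ er _ (pow_generated (m := m) gG)) => z; exists (subm_val z).
- by move=> y; have [x hx] := pms (al y); exists (er x); rewrite p'E -[subm_val _]/(e x) eE hx !bal.
- move=> z hz z0; apply: val_inj; apply: pmj; first exact: (sub_incl_homog hz).
  by rewrite pmE z0 raddf0.
have hi n (z : gsubmod (gker p')) :
    gr_comp (pow_proj G n) (gr_comp (sub_incl (gim e)) (sub_incl (gker p'))) z
      \in gspred (gker p).
  apply/gkerP; apply: (pm0 n (subm_val (subm_val z))).
  by rewrite pmE; have /gkerP -> := submP z; rewrite raddf0.
pose i := pow_tuple (fun n => corestr (hi n)).
have hr (y : gr_pow (gsubmod (gker p)) m) :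
    gr_comp er (pow_map m (sub_incl (gker p))) y \in gspred (gker p').
  apply/gkerP; rewrite p'E -[subm_val _]/(e _) eE.
  suff -> : pm (pow_map m (sub_incl (gker p)) y) = 0 by rewrite !raddf0.
  apply/ffunP => n; rewrite !ffunE /= ffunE /=.
  by have /gkerP := submP ((y : {ffun 'I_m -> gsubmod (gker p)}) n).
exists i, (corestr hr) => z; apply: val_inj; apply: val_inj => /=.
rewrite -[RHS]eK; congr (e _); apply/ffunP => n.
by rewrite !ffunE.
Qed.

Lemma linear_resolution_retract n j M X m
    (al : grhom X (gr_pow M m)) (be : grhom (gr_pow M m) X) :
  (forall x, be (al x) = x) -> linear_resolution j n M -> linear_resolution j n X.
Proof.
elim: n j M X m al be => [|n IH] j M X m al be bal [G [p [PG gG ps pj h]]];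
  have [G' [p' [PG' gG' ps' pj' [i [r ri]]]]] := retract_cover bal PG gG ps pj;
  exists G', p'; split=> //; last exact: IH ri h.
move=> x /gkerP hx; have := ri (Subm hx); have -> : i (Subm hx) = 0; last first.
  by rewrite raddf0 => /(congr1 val).
apply/ffunP => n; rewrite ffunE; apply: val_inj; apply: h.
by have /gkerP := submP ((i (Subm hx) : {ffun 'I_m -> gsubmod (gker p)}) n).
Qed.

Lemma linear_resolution_pdim n j M : linear_resolution j n M -> pdim_le M n.
Proof.
elim: n j M => [|n IH] j M [G [p [PG _ ps _ h]]].
  pose Z := gsubmod (gzero M).
  have Z0 (z : Z) : z = 0 by apply: val_inj; apply/eqP; exact: (submP z).
  have PZ : gr_projective Z.
    by move=> L N q f qs; exists (gr_zero Z L) => x; rewrite [x]Z0 !raddf0.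
  pose O i : grmod A := if i is 0%N then G else Z.
  pose D i : grhom (O i.+1) (O i) := gr_zero Z (O i).
  have PO i : gr_projective (O i) by case: i.
  have e0 x : p x = 0 <-> exists y, x = D 0%N y.
    split=> [/h ->|[y ->]]; last by rewrite raddf0.
    by exists 0; rewrite raddf0.
  have e1 i x : D i x = 0 <-> exists y, x = D i.+1 y.
    by split=> [_|//]; exists 0; rewrite raddf0; exact: Z0.
  exists (@ProjResolution k A M O D p PO ps e0 e1) => i; by case: i => // i _ x; exact: Z0.
have [R R0] := IH _ _ h.
pose O i : grmod A := if i is i'.+1 then R i' else G.
pose D i : grhom (O i.+1) (O i) :=
  match i return grhom (O i.+1) (O i) with
  | 0%N => gr_comp (sub_incl (gker p)) (pr_aug R)
  | i'.+1 => pr_diff R i'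
  end.
have PO i : gr_projective (O i) by case: i => //= i; exact: pr_proj.
have e0 x : p x = 0 <-> exists y, x = D 0%N y.
  split=> [/gkerP hx|[y ->]]; last exact/gkerP/(submP (pr_aug R y)).
  by have [y hy] := pr_aug_surj R (Subm hx); exists y; rewrite /= hy.
have e1 i x : D i x = 0 <-> exists y, x = D i.+1 y.
  case: i x => [|i] x; last exact: pr_exact.
  rewrite -pr_exact0; split=> [hx|h0]; last by rewrite /= h0.
  exact: val_inj.
by exists (@ProjResolution k A M O D p PO ps e0 e1); case.
Qed.

End PowMaps.

(** * The dual complex *)

Section Unopp.
Variables (k : fieldType) (B : gralg k).
Let C := gr_opp (gr_opp B).

(** B and its double opposite have the same elements and the same product but are
    different objects; [unopp] carries modules over the latter back to B. *)
Definition unopp_sort (M : grmod C) : Type := M.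
Section UnoppModule.
Variable M : grmod C.
HB.instance Definition _ := GRing.Zmodule.on (unopp_sort M).
Definition unopp_scale (b : B) (x : unopp_sort M) : unopp_sort M := (b : C) *: (x : M).
Lemma unopp_scaleA a b x : unopp_scale a (unopp_scale b x) = unopp_scale (a * b) x.
Proof. exact: (scalerA (a : C) (b : C) (x : M)). Qed.
Lemma unopp_scale1 : left_id 1 unopp_scale.
Proof. exact: (@scale1r C M). Qed.
Lemma unopp_scaleDr : right_distributive unopp_scale +%R.
Proof. by move=> a x y; exact: (scalerDr (a : C) (x : M) y). Qed.
Lemma unopp_scaleDl x : {morph unopp_scale^~ x : a b / a + b}.
Proof. by move=> a b; exact: (scalerDl (x : M) (a : C) b). Qed.
HB.instance Definition _ := GRing.Zmodule_isLmodule.Build B (unopp_sort M)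
  unopp_scaleA unopp_scale1 unopp_scaleDr unopp_scaleDl.
Definition unopp : grmod B :=
  @GrMod k B (unopp_sort M) (mgr M : grading (unopp_sort M)) (@mgrZ k C M).
End UnoppModule.

Variable P : proj_resolution (Smod (gr_opp B)).
Hypothesis gP : forall n : nat, generated_in_degree (P n) n.
Variable d : nat.
Hypothesis extP : Ext_condition (gr_opp B) d d.

(** The dual of P_i, shifted by d so that the dual of P_d is generated in degree
    0, where the module D(S) that it covers lives. *)
Definition dual_term i : grmod B := gr_shift (unopp (gr_Hom (P i))) (- d%:Z).

Lemma dual_diff_linear i :
  linear (fun f : dual_term i => precomp_fun (pr_diff P i) f : dual_term i.+1).
Proof. by move=> a f g; apply: val_inj. Qed.
Lemma dual_diff_homog i n f : f \in homog (mgr (dual_term i)) n ->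
  (precomp_fun (pr_diff P i) f : dual_term i.+1) \in homog (mgr (dual_term i.+1)) n.
Proof. exact: (@ghom_homog _ _ _ _ (precomp (pr_diff P i)) (n - d%:Z)). Qed.
Definition dual_diff i : grhom (dual_term i) (dual_term i.+1) :=
  mk_grhom (@dual_diff_linear i) (@dual_diff_homog i).

Lemma dual_expand i m (u : 'I_m -> P i) h (f : homm (P i)) : dual_basis i u h ->
  (f : dual_term i) = \sum_j (f (u j) : B) *: (h j : dual_term i).
Proof.
move=> [_ _ hx]; apply: eq_homm => t x _.
have sumE (I : Type) (r : seq I) (F : I -> dual_term i) :
    (\sum_(j <- r) F j : homm (P i)) x = \sum_(j <- r) ((F j : homm (P i)) x : B) :> B.
  by elim: r => [|j r IH]; rewrite ?big_nil // !big_cons -IH.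
rewrite [RHS]sumE {1}[x]hx.
elim/big_rec2: _ => [|j y z _ <-]; first exact: (homm0 f).
exact: (homm_lin f).
Qed.

Lemma dual_term_gen i : generated_in_degree (dual_term i) (d%:Z - i%:Z).
Proof.
have [m [u [h hb]]] := lin_dual_basis gP i; have [_ hh _] := hb.
move=> f; rewrite (dual_expand f hb); apply: (@gen_elt_sum _ _ (dual_term i)) => j.
exists [:: ((f : homm (P i)) (u j) : B, h j : dual_term i)]; rewrite big_seq1; split=> // p.
rewrite inE => /eqP-> /=; rewrite homogE /= /shift_comp.
by rewrite addrAC subrr add0r; exact: hh.
Qed.

Lemma dual_term_proj i : gr_projective (dual_term i).
Proof.
have [m [u [h hb]]] := lin_dual_basis gP i; have [hu hh _] := hb.
move=> M N p f ps; pose e : int := d%:Z - i%:Z.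
have hdeg j : (h j : dual_term i) \in homog (mgr (dual_term i)) e.
  by rewrite homogE /= /shift_comp /e addrAC subrr add0r; exact: hh.
have /fin_all_exists2[v hv vE] (j : 'I_m) : exists2 v : M, v \in homog (mgr M) e &
    p v = f (h j).
  have [w hw] := ps (f (h j)); exists (mgr M e w); first exact: gcomp_in.
  by rewrite ghomC hw -ghomC (eqP (hdeg j)).
have lin : linear (fun g : dual_term i => \sum_j ((g : homm (P i)) (u j) : B) *: v j).
  move=> a x y; rewrite scaler_sumr -big_split; apply: eq_bigr => j _ /=.
  by rewrite scalerA -scalerDl.
have hom n g : g \in homog (mgr (dual_term i)) n ->
    \sum_j ((g : homm (P i)) (u j) : B) *: v j \in homog (mgr M) n.
  move=> hg; apply: homog_sum => j.
  (* u j has degree i and g has degree n - d as a function. *)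
  have hgu : ((g : homm (P i)) (u j) : B) \in homog (algr B) (i%:Z + (n - d%:Z)).
    exact: (homm_homog (hg : (g : homm (P i)) \in homog (homm_grading _) (n - d%:Z)) (hu j)).
  have := mgrZ hgu (hv j).
  by rewrite /e [i%:Z + _]addrC addrACA subrK subrr addr0.
exists (mk_grhom lin hom) => g; rewrite mk_grhomE [in RHS](dual_expand g hb) !raddf_sum.
apply: eq_bigr => j _.
transitivity (((g : homm (P i)) (u j) : B) *: p (v j)); first exact: (linearZ_LR p).
by rewrite vE; symmetry; exact: (linearZ_LR f).
Qed.

(** The resolution is P_i^* <- P_(i-1)^* <- ... <- P_0^*. Below d the cocycles are
    the coboundaries, so the kernel of the cover by P_i^* is again a cokernel, that
    of P_(i-2)^* -> P_(i-1)^*, which permits induction on i. *)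
Lemma dual_term_linear_resolution i M (p : grhom (dual_term i) M) : (i <= d)%N ->
  (forall y, exists x, p x = y) -> (forall f, p f = 0 <-> coboundary (f : homm (P i))) ->
  linear_resolution (d%:Z - i%:Z) i M.
Proof.
elim: i M p => [|i IH] M p id ps p0.
  exists (dual_term 0), p; split=> //; [exact: dual_term_proj|exact: dual_term_gen| |].
    by move=> x _ /p0.
  by move=> x /p0.
exists (dual_term i.+1), p; split=> //; [exact: dual_term_proj|exact: dual_term_gen| |].
  move=> x hx /p0 cx; have [g hg xg] := coboundary_homog hx cx.
  have g0 : g = 0.
    apply: (homm_low0 gP _ hg).
    by rewrite [d%:Z - _ - _]addrAC subrr add0r intS opprD addrCA subrr.
  by apply/val_inj/funext => y; rewrite /= xg g0.
have hq (f : dual_term i) : dual_diff i f \in gspred (gker p).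
  by apply/gkerP/p0; exists f.
have := @IH _ (corestr hq) (ltnW id).
have -> : d%:Z - i.+1%:Z + 1 = d%:Z - i%:Z by rewrite intS opprD [- 1 - _]addrC addrA subrK.
apply.
  move=> [y hy]; have /gkerP/p0[g hg] := hy; exists g.
  by apply/val_inj/val_inj/funext => x /=; rewrite hg.
move=> f; split=> [f0|cf].
  apply: (ext_exact extP); first by rewrite neq_ltn id.
  by move=> x; have /(congr1 val)/(congr1 (fun g : homm _ => g x)) := f0.
apply/val_inj/val_inj/funext => x /=; exact: (coboundary_cocycle cf).
Qed.

Let A := gr_opp B.
(** D(S) as a left B-module. *)
Definition left_dual : grmod B := unopp (dualS A).

Lemma conc_homogP (V : zmodType) n (x : V) :
  x \in homog (conc_grading V) n <-> n = 0 \/ x = 0.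
Proof.
rewrite homogE /= /conc_comp; have [->|n0] := eqVneq n 0.
  by rewrite eqxx; split=> // _; left.
by split=> [/eqP<-|[/eqP|->//]]; [right | rewrite (negbTE n0)].
Qed.

Lemma left_dual_linear_resolution : linear_resolution 0 d left_dual.
Proof.
have [kap [kapD' kapZ' kap0 kapdeg kapS]] := ext_dual P extP.
have cyc := all_cocycle gP extP.
have lk : linear (fun f : dual_term d => kap f : left_dual).
  move=> a f g; have := kapD' (a *: f) g (cyc _) (cyc _).
  by rewrite (kapZ' (a : gr_opp A)).
have hk n (f : dual_term d) : f \in homog (mgr (dual_term d)) n ->
    (kap f : left_dual) \in homog (mgr left_dual) n.
  move=> hf; apply/conc_homogP; have [->|n0] := eqVneq n 0; first by left.
  right; apply/(kap0 _ (cyc _)); apply: (kapdeg (n - d%:Z)) => //.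
  by rewrite -subr_eq0 opprK subrK.
have := @dual_term_linear_resolution d left_dual (mk_grhom lk hk) (leqnn d).
rewrite subrr; apply.
  by move=> e; have [f [_ _ <-]] := kapS e; exists f.
by move=> f; exact: kap0.
Qed.

Definition deg0_opp (s : deg0 A) : deg0 B := @Deg0 k B (s : A) (deg0P s).

(** [dual_deg0_generates] makes S a retract of a power of D(S), as a left
    S-module; as B acts on both through S, also as a graded B-module. *)
Lemma Smod_linear_resolution : linear_resolution 0 d (Smod B).
Proof.
have [N [l [p [hl hp pl]]]] := dual_deg0_generates gP extP.
pose e i : dual A := Dual (linear_form_dual (hl i)).
have kfd (f : dual A) : linear_form f by move=> a x y; rewrite dual_linear.
have alL i : linear (fun s : Smod B => (deg0_val s : gr_opp A) *: e i : left_dual).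
  move=> a x y.
  rewrite -[RHS]/((a : gr_opp A) *: ((deg0_val x : gr_opp A) *: e i) +
    (deg0_val y : gr_opp A) *: e i).
  rewrite scalerA -scalerDl.
  apply/val_inj/funext => t /=; congr (l i (_ * t)); apply: val_inj => /=.
  change (algr B 0 (algr B 0 a * deg0_val x + deg0_val y) =
    algr B 0 (a * deg0_val x + deg0_val y)).
  by rewrite !(raddfD (algr B 0)) /= !algr0M gcompK eqxx.
have alH i n (s : Smod B) : s \in homog (mgr (Smod B)) n ->
    ((deg0_val s : gr_opp A) *: e i : left_dual) \in homog (mgr left_dual) n.
  move=> /conc_homogP[->|s0]; apply/conc_homogP; [by left | right].
  by rewrite s0; exact: (scale0r (e i)).
pose be (i : 'I_N) (f : left_dual) : Smod B := deg0_opp (p i (dual_fun f)).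
have beL i : linear (be i).
  move=> a f g; apply: val_inj.
  change (deg0_val (p i (fun s => form_mulr (dual_fun f) (proj0 (a : A)) s + dual_fun g s)) =
    algr B 0 a * deg0_val (p i (dual_fun f)) + deg0_val (p i (dual_fun g)) :> B).
  by rewrite (dual_homD (hp i)) ?(dual_homM (hp i)) //; exact: linear_form_mulr.
have beH i n (f : left_dual) : f \in homog (mgr left_dual) n ->
    be i f \in homog (mgr (Smod B)) n.
  move=> /conc_homogP[->|f0]; apply/conc_homogP; [by left | right].
  rewrite f0; apply: val_inj.
  exact: (congr1 (@deg0_val k A) (dual_hom0 (hp i))).
apply: (@linear_resolution_retract k B d 0 left_dual (Smod B) N
  (pow_tuple (fun i => mk_grhom (alL i) (alH i)))
  (pow_sum (fun i => mk_grhom (beL i) (beH i)))) left_dual_linear_resolution => s.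
have sumE (r : seq 'I_N) (F : 'I_N -> deg0 A) :
    \sum_(i <- r) (deg0_opp (F i) : Smod B) = deg0_opp (\sum_(i <- r) F i).
  elim: r => [|i r IH]; first by rewrite !big_nil; exact: val_inj.
  by rewrite !big_cons IH; exact: val_inj.
rewrite mk_grhomE.
transitivity (deg0_opp (\sum_i p i (form_mulr (l i) (proj0 (deg0_val s : A))))).
  by rewrite -sumE; apply: eq_bigr => i _; rewrite ffunE.
under eq_bigr => i _ do rewrite (dual_homM (hp i)) //.
rewrite -mulr_suml pl mul1r; apply: val_inj; apply/eqP; exact: deg0P.
Qed.

Lemma left_pdim_le : pdim_le (Smod B) d.
Proof. exact: linear_resolution_pdim Smod_linear_resolution. Qed.

End Unopp.

(** * Projective dimensions *)

Lemma pdim_lower_bound (k : fieldType) (A : gralg k) d l m :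
  Ext_condition A d l -> pdim_le (Smod A) m -> (d <= m)%N.
Proof.
move=> extP [P Pm]; rewrite leqNgt; apply/negP => md.
have [kap [_ kapZ _ _ kapS]] := ext_dual P extP.
have [e e0] := dual_nonzero A; have [f [cf _ ef]] := kapS e.
have f0 : f = 0 by apply/val_inj/funext => x; rewrite (Pm d md x); exact: (homm0 f).
by apply: e0; rewrite -ef; have := kapZ 0 f cf; rewrite !scale0r f0.
Qed.

Theorem proposition4p1p2 (k : fieldType) (B : gralg k) (d : nat) :
  standard_Koszul_AS_Gorenstein B d ->
  pdim_eq (Smod (gr_opp B)) d /\ pdim_eq (Smod B) d.
Proof.
move=> [l [[_ _ extR extL] [_ _ [P gP]] ld]]; rewrite ld in extR extL.
split; split; try by move=> m; apply: pdim_lower_bound; eassumption.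
  by exists P => n dn x; exact: (lin_vanish gP extR x dn).
exact: (@left_pdim_le k B P gP d extR).
Qed.
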